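(* Let $n\ge 4$, let $A\subseteq\mathbb{R}$ and $I\subseteq[1,2]$ be compact intervals, and let $g:A\times I\to\mathbb{R}$ be nondegenerate away from the origin. For $a\in A$ let $\Gamma_a=\{(X,g(a,|X|))\in\mathbb{R}^{n-1}\times\mathbb{R}:|X|\in I'\}$, where $I'$ is the compact interval with the same right endpoint as $I$ and length $|I|/2$. Then there is a constant $C$ depending only on $n$, $|I|$, $\|g\|_{\mathrm{reg}}$, $\inf_{A\times I}|g_t|$ and $\lambda_1$ such that for all $a,\bar a\in A$, $$\sup_{\tau\in\mathbb{R}^n}\big|(\Gamma_a(\delta)+\tau)\cap\Gamma_{\bar a}(\delta)\big|\le C\,\frac{\delta^2}{\delta+|\bar a-a|}\qquad\text{for all }\delta\in(0,1).$$
   Context: Subscripts denote partial derivatives of $g(a,t)$. For a function $g$ on $A\times I$ put $\|g\|_\infty=\sup_{A\times I}|g|$, $\|g\|_{\mathrm{Lip}}=\sup_{(\bar a,\bar t)\neq(a,t)\in A\times I}\frac{|g(\bar a,\bar t)-g(a,t)|}{|\bar a-a|+|\bar t-t|}$, and $\|g\|_{\mathrm{reg}}=\|g_t\|_\infty+\|g_t\|_{\mathrm{Lip}}+\|g_{tt}\|_{\mathrm{Lip}}$ (finiteness includes the existence of $g_t,g_{tt}$ on $A\times I$). Given compact intervals $A\subseteq\mathbb{R}$, $I\subseteq[1,2]$, a function $g:A\times I\to\mathbb{R}$ is called nondegenerate away from the origin if (a) $\|g\|_{\mathrm{reg}}<\infty$; and (b) $g_t(a,t)\ne0$ for all $(a,t)\in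 A\times I$ and $\lambda_1:=\inf_{t\in I}\inf_{\bar a\ne a\in A}\frac{|g_t(\bar a,t)-g_t(a,t)|}{|\bar a-a|}>0$. For $E\subseteq\mathbb{R}^n$, $E(\delta)=\{x+y:x\in E,\ |y|<\delta\}$ is the $\delta$-neighbourhood and $|E|$ denotes Lebesgue measure; for an interval, $|I|$ is its length. *)

(* Defs.v *)
From HB Require Import structures.
From mathcomp Require Import all_boot all_order all_algebra.
From mathcomp Require Import all_classical all_reals all_analysis.

Set Implicit Arguments.
Unset Strict Implicit.
Unset Printing Implicit Defensive.

Import Order.TTheory GRing.Theory Num.Theory.
Import numFieldNormedType.Exports.

Local Open Scope classical_set_scope.
Local Open Scope ring_scope.

Section PartialDerivatives.
Variable R : realType.
Implicit Types (A I : set R) (g : R -> R -> R).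

(* A function on A x I is represented by a total g : R -> R -> R; none of the
   notions below depends on its values outside A x I.  In particular the
   derivatives in t are taken within I, hence one-sided at its endpoints. *)
Definition derivable_within I (f : R -> R) (t : R) : Prop :=
  cvg ((f s - f t) / (s - t) @[s --> within I t^']).

Definition partial_t I g (a t : R) : R :=
  lim ((g a s - g a t) / (s - t) @[s --> within I t^']).

Definition sup_norm A I g : \bar R :=
  ereal_sup [set (`|g p.1 p.2|)%:E | p in A `*` I].

Definition lip_norm A I g : \bar R :=
  ereal_sup [set (`|g pq.2.1 pq.2.2 - g pq.1.1 pq.1.2| /
                  (`|pq.2.1 - pq.1.1| + `|pq.2.2 - pq.1.2|))%:E
            | pq in [set pq : (R * R) * (R * R) |
                (A `*` I) pq.1 /\ (A `*` I) pq.2 /\ pq.2 != pq.1]].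

Definition has_t_derivatives A I g : Prop :=
  forall a t, A a -> I t ->
    derivable_within I (g a) t /\ derivable_within I (partial_t I g a) t.

Definition reg_norm A I g : \bar R :=
  if `[< has_t_derivatives A I g >]
  then (sup_norm A I (partial_t I g) + lip_norm A I (partial_t I g)
        + lip_norm A I (partial_t I (partial_t I g)))%E
  else +oo%E.

Definition inf_abs_partial_t A I g : \bar R :=
  ereal_inf [set (`|partial_t I g p.1 p.2|)%:E | p in A `*` I].

(* Equal to +oo when A is a single point. *)
Definition lambda1 A I g : \bar R :=
  ereal_inf [set ereal_inf
      [set (`|partial_t I g p.2 t - partial_t I g p.1 t| / `|p.2 - p.1|)%:E
      | p in [set p : R * R | A p.1 /\ A p.2 /\ p.2 != p.1]]
    | t in I].

Definition nondegenerate_away_from_origin A I g : Prop :=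
  (reg_norm A I g < +oo)%E /\
  ((forall a t, A a -> I t -> partial_t I g a t != 0) /\
   (0 < lambda1 A I g)%E).

End PartialDerivatives.

Section EuclideanSpace.
Variable R : realType.

(* The library's norm on 'rV[R]_n is the sup norm. *)
Definition enorm n (x : 'rV[R]_n) : R := Num.sqrt (\sum_i x 0 i ^+ 2).

Definition neighbourhood n (E : set 'rV[R]_n) (delta : R) : set 'rV[R]_n :=
  [set z | exists x y, E x /\ enorm y < delta /\ z = x + y].

Definition translate n (E : set 'rV[R]_n) (tau : 'rV[R]_n) : set 'rV[R]_n :=
  [set x + tau | x in E].

(* n-dimensional Lebesgue measure, as the n-fold product of lebesgue_measure:
   the successor case is the library's product measure \x (integral of the
   measures of the sections) transported along R x R^n ~ R^(n+1).  It is
   meant for Borel sets. *)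
Fixpoint lebesgue_rV (n : nat) : set 'rV[R]_n -> \bar R :=
  match n with
  | 0 => fun E => (\1_E (0 : 'rV[R]_0))%:E
  | m.+1 => fun E => (\int[lebesgue_measure]_(x in [set: R])
      @lebesgue_rV m [set v : 'rV[R]_m | E (row_mx (x%:M : 'M[R]_1) v)])%E
  end.

(* The point (X, y) of R^n x R, as a vector of R^(n+1). *)
Definition append_coord n (X : 'rV[R]_n) (y : R) : 'rV[R]_n.+1 :=
  \row_i (if unlift ord_max i is Some j then X 0 j else y).

Definition Gamma n (I' : set R) (g : R -> R -> R) (a : R) : set 'rV[R]_n.+1 :=
  [set append_coord X (g a (enorm X)) | X in [set X : 'rV[R]_n | I' (enorm X)]].

End EuclideanSpace.

(* Main.v *)
Require Import Defs.
From HB Require Import structures.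
From mathcomp Require Import all_boot all_order all_algebra.
From mathcomp Require Import all_classical all_reals all_analysis.
From mathcomp Require Import measurable_realfun ring lra.

Set Implicit Arguments.
Unset Strict Implicit.
Unset Printing Implicit Defensive.

Import Order.TTheory GRing.Theory Num.Theory.
Import numFieldNormedType.Exports.

Local Open Scope classical_set_scope.
Local Open Scope ring_scope.

(** Write tau = (T, tau_n), F = g(a, .), G = g(abar, .), D = |abar - a|. A point
    (X, y) of the intersection comes with radii r, s in I', d-close to |X| and
    |X - T|, with |y - G r| <= d and |y - tau_n - F s| <= d. By the mean value
    theorem G - F expands distances by lambda_1 D, and |r - s| <= |T| + 2 d, so
    r stays in an interval of length O((d + |T|) / D). Cut that interval into
    pieces of length d: on each piece |X|, y and (because F' is bounded away
    from 0) also |X - T| vary by O(d), so |X|^2 and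
    2 X . T = |X|^2 - |X - T|^2 + |T|^2 vary by O(d). The set of X in R^(n-1)
    with |X|^2 and X . T in intervals of lengths w and z has measure
    O(w z / |T|); this is where n >= 4 is used, since the slices X . T = const
    are then annuli of dimension at least 2, whose measure is O(w). Hence each
    piece has measure O(d^3 / |T|), or O(d^2) without using X . T, and summing
    over the pieces gives O(d^2 / D) in both cases |T| >= d and |T| < d. When
    D <= d the O(d^2) bound over O(1 / d) pieces is enough. *)

(** * Lebesgue measure on row vectors *)

Section insertion.
Variable R : realType.

(** Every position [j] is allowed: [ord0] is the coordinate split off by [lebesgue_rV], [ord_max]
    gives [append_coord], and the slab estimate singles out a coordinate where T does not vanish. *)
Definition insert_coord m (j : 'I_m.+1) (x : R) (v : 'rV[R]_m) : 'rV[R]_m.+1 :=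
  \row_i (if unlift j i is Some k then v 0 k else x).

Definition remove_coord m (j : 'I_m.+1) (v : 'rV[R]_m.+1) : 'rV[R]_m :=
  \row_k v 0 (lift j k).

Lemma insert_coord_at m (j : 'I_m.+1) x v : insert_coord j x v 0 j = x.
Proof. by rewrite mxE unlift_none. Qed.

Lemma insert_coord_lift m (j : 'I_m.+1) x v k :
  insert_coord j x v 0 (lift j k) = v 0 k.
Proof. by rewrite mxE liftK. Qed.

Lemma remove_coordK m (j : 'I_m.+1) (v : 'rV[R]_m.+1) :
  insert_coord j (v 0 j) (remove_coord j v) = v.
Proof.
by apply/rowP => i; rewrite mxE; case: unliftP => [k ->|->]; rewrite ?mxE.
Qed.

Lemma insert_coordK m (j : 'I_m.+1) x (v : 'rV[R]_m) :
  remove_coord j (insert_coord j x v) = v.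
Proof. by apply/rowP => k; rewrite mxE insert_coord_lift. Qed.

(** This commutation is what allows two integrations to be exchanged in [lebesgue_rV_insert]. *)
Lemma insert_coord_lift0 m (j : 'I_m.+1) x y (v : 'rV[R]_m) :
  insert_coord (lift ord0 j) y (insert_coord ord0 x v) =
  insert_coord ord0 x (insert_coord j y v).
Proof.
apply/rowP => i; have [k ->|->] := unliftP ord0 i.
  rewrite insert_coord_lift; have [l ->|->] := unliftP j k.
    rewrite insert_coord_lift.
    have -> : lift ord0 (lift j l) = lift (lift ord0 j) (lift ord0 l).
      by apply/val_inj; rewrite /= /bump/= !add1n ltnS; case: leqP.
    by rewrite !insert_coord_lift.
  by rewrite !insert_coord_at.
rewrite insert_coord_at.
have -> : ord0 = lift (lift ord0 j) ord0 :> 'I_m.+2 by exact/val_inj.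
by rewrite insert_coord_lift insert_coord_at.
Qed.

Lemma row_mx_insert_coord m x (v : 'rV[R]_m) :
  row_mx (x%:M : 'M[R]_1) v = insert_coord ord0 x v.
Proof.
apply/rowP => i; have [k ->|->] := unliftP ord0 i.
  rewrite insert_coord_lift -[RHS](@row_mxEr _ _ 1 m (x%:M : 'M[R]_1) v).
  by congr (row_mx _ _ _ _); apply/val_inj.
rewrite insert_coord_at.
have -> : ord0 = lshift m (ord0 : 'I_1) by apply/val_inj.
by rewrite row_mxEl mxE eqxx.
Qed.

Lemma lebesgue_rVS m (E : set 'rV[R]_m.+1) :
  lebesgue_rV E =
  (\int[lebesgue_measure]_x lebesgue_rV [set v | E (insert_coord ord0 x v)])%E.
Proof.
rewrite /=; apply: eq_integral => x _; congr lebesgue_rV.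
by apply/seteqP; split => v /=; rewrite row_mx_insert_coord.
Qed.

End insertion.

(** * The sigma-algebra of row vectors *)

Definition rV_display : measure_display. Proof. exact: default_measure_display. Qed.

Section measurable_rV.
Variables (R : realType) (n : nat).

Let coors : 'I_n -> 'rV[R]_n -> R := fun i x => x 0 i.

Let rV_set0 : g_sigma_preimage coors set0.
Proof. exact: sigma_algebra0. Qed.

Let rV_setC A : g_sigma_preimage coors A -> g_sigma_preimage coors (~` A).
Proof. exact: sigma_algebraC. Qed.

Let rV_bigcup (F : _^nat) : (forall i, g_sigma_preimage coors (F i)) ->
  g_sigma_preimage coors (\bigcup_i (F i)).
Proof. exact: sigma_algebra_bigcup. Qed.

(** The sigma-algebra generated by the coordinate functions, that is, the Borel sets of R^n. *)
HB.instance Definition _ := @isMeasurable.Build rV_display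
  'rV[R]_n (g_sigma_preimage coors) rV_set0 rV_setC rV_bigcup.

Lemma measurable_coord (i : 'I_n) :
  measurable_fun [set: 'rV[R]_n] (fun x : 'rV[R]_n => x 0 i).
Proof.
move=> _ Y mY; rewrite setTI; apply: sub_sigma_algebra => /=.
rewrite -bigcup_seq/=; exists i => /=; first by rewrite mem_index_enum.
by exists Y => //; rewrite setTI.
Qed.

Lemma measurable_fun_coord d (T : measurableType d) (f : T -> 'rV[R]_n) :
  (forall i, measurable_fun [set: T] (fun x => f x 0 i)) ->
  measurable_fun [set: T] f.
Proof.
move=> mf _ A mA; rewrite setTI.
have : preimage_set_system [set: T] f (g_sigma_preimage coors) `<=` measurable.
  rewrite -g_sigma_preimage_comp.
  apply: smallest_sub; first exact: sigma_algebra_measurable.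
  rewrite -bigcup_seq; apply: bigcup_sub => i _.
  by move=> B [C mC <-]; exact: mf.
by apply; exists A => //; rewrite setTI.
Qed.

End measurable_rV.

Section measurable_insert.
Variable R : realType.

Lemma measurable_insert_coord d (T : measurableType d) m (j : 'I_m.+1)
    (f : T -> R) (g : T -> 'rV[R]_m) :
  measurable_fun setT f -> measurable_fun setT g ->
  measurable_fun setT (fun t => insert_coord j (f t) (g t)).
Proof.
move=> mf mg; apply: measurable_fun_coord => i.
have [k ->|->] := unliftP j i.
  under eq_fun do rewrite insert_coord_lift.
  by apply: (measurableT_comp (measurable_coord k)).
by under eq_fun do rewrite insert_coord_at.
Qed.

Lemma measurable_remove_coord m (j : 'I_m.+1) :
  measurable_fun setT (@remove_coord R m j).
Proof.
apply: measurable_fun_coord => i.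
under eq_fun do rewrite mxE.
exact: measurable_coord.
Qed.

(** By induction, [lebesgue_rV] is the image under coordinate insertion of the product of the line
    measure with the previous one. Sigma-finiteness is carried along because the next product
    requires it. *)
Lemma lebesgue_rV_measure n :
  exists mu : {sigma_finite_measure set 'rV[R]_n -> \bar R},
    forall E, mu E = lebesgue_rV E.
Proof.
elim: n => [|m [mu muE]].
  by exists (dirac (0 : 'rV[R]_0)).
pose phi (z : measurableTypeR R * 'rV[R]_m) : 'rV[R]_m.+1 := insert_coord ord0 z.1 z.2.
have mphi : measurable_fun setT phi by exact: measurable_insert_coord.
pose pm : {measure set (measurableTypeR R * 'rV[R]_m)%type -> \bar R} :=
  (@lebesgue_measure R \x mu)%E.
pose nu0 : {measure set 'rV[R]_m.+1 -> \bar R} := pushforward pm phi.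
pose nu : {measure set 'rV[R]_m.+1 -> \bar R} := nu0 mphi.
have nusf : sigma_finite setT nu.
  have /sigma_finiteP[F [FT ndF Foo]] := sigma_finiteT (@lebesgue_measure R).
  have /sigma_finiteP[G [GT ndG Goo]] := sigma_finiteT mu.
  (* Rectangles of finite measure; both exhausting sequences increase, so two indices can be
     replaced by their maximum. *)
  pose H k := [set v : 'rV[R]_m.+1 | F k (v 0 ord0) /\ G k (remove_coord ord0 v)].
  exists H.
    apply/seteqP; split => // v _.
    have [i _ Fi] : (\bigcup_i F i) (v 0 ord0) by rewrite -FT.
    have [j _ Gj] : (\bigcup_i G i) (remove_coord ord0 v) by rewrite -GT.
    exists (maxn i j) => //; split.
      by move: Fi; exact/subsetPset/ndF/leq_maxl.
    by move: Gj; exact/subsetPset/ndG/leq_maxr.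
  move=> k; have [mF Fk] := Foo k; have [mG Gk] := Goo k; split.
    apply: measurableI.
      rewrite -[X in measurable X]setTI.
      exact: (@measurable_coord R m.+1 ord0).
    rewrite -[X in measurable X]setTI.
    exact: measurable_remove_coord.
  rewrite /nu /nu0/= /pushforward.
  have -> : phi @^-1` H k = F k `*` G k.
    by apply/seteqP; split => -[x v]; rewrite /H /phi /= insert_coord_at insert_coordK.
  by rewrite /pm/= product_measure1E// lte_mul_pinfty// ge0_fin_numE.
pose nusf_mixin := Measure_isSigmaFinite.Build _ _ _ nu nusf.
pose NU : {sigma_finite_measure set 'rV[R]_m.+1 -> \bar R} :=
  HB.pack (Measure.sort nu) nusf_mixin.
exists NU => E; rewrite lebesgue_rVS /NU/= /nu/= /nu0/= /pushforward/=.
apply: eq_integral => x _; rewrite /= muE; congr lebesgue_rV.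
by apply/seteqP; split => v /=; rewrite /xsection/= inE.
Qed.

End measurable_insert.

Section lebesgue_rV_isMeasure.
Variables (R : realType) (n : nat).

Let l0 : @lebesgue_rV R n set0 = 0%E.
Proof. by have [mu <-] := lebesgue_rV_measure R n; rewrite measure0. Qed.

Let lge0 E : (0 <= @lebesgue_rV R n E)%E.
Proof.
elim: n E => [|m IH] E; first by rewrite /= lee_fin.
by rewrite lebesgue_rVS; exact: integral_ge0.
Qed.

Let lsigma : semi_sigma_additive (@lebesgue_rV R n).
Proof.
have [mu /funext <-] := lebesgue_rV_measure R n.
exact: measure_semi_sigma_additive.
Qed.

HB.instance Definition _ := isMeasure.Build _ _ _ (@lebesgue_rV R n)
  l0 lge0 lsigma.

Let lsf : sigma_finite setT (@lebesgue_rV R n).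
Proof.
have [mu /funext <-] := lebesgue_rV_measure R n.
exact: sigma_finiteT.
Qed.

HB.instance Definition _ := Measure_isSigmaFinite.Build _ _ _ (@lebesgue_rV R n)
  lsf.

Lemma lebesgue_rV_ge0 E : (0 <= @lebesgue_rV R n E)%E.
Proof. exact: lge0. Qed.

End lebesgue_rV_isMeasure.

(* The integral of a non-negative function is a supremum over the simple
   functions below it, hence monotone without any measurability. *)
Lemma ge0_le_integralT d (T : measurableType d) (R : realType)
    (mu : {measure set T -> \bar R}) (f g : T -> \bar R) :
  (forall x, 0 <= f x)%E -> (forall x, f x <= g x)%E ->
  (\int[mu]_x f x <= \int[mu]_x g x)%E.
Proof.
move=> f0 fg.
have g0 x : (0 <= g x)%E := le_trans (f0 x) (fg x).
rewrite !ge0_integralTE//; apply: le_ereal_sup => _ [h /= hf <-].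
by exists h => //= x; exact: le_trans (hf x) (fg x).
Qed.

(** Stated for arbitrary sets, so that the intersection of the two neighbourhoods can be bounded
    through measurable supersets. *)
Lemma le_lebesgue_rV (R : realType) n (E F : set 'rV[R]_n) :
  E `<=` F -> (lebesgue_rV E <= lebesgue_rV F)%E.
Proof.
elim: n E F => [|m IH] E F EF.
  rewrite lee_fin !indicE ler_nat.
  have [/[!inE] /EF F0|//] := boolP (0 \in E).
  by rewrite mem_set.
rewrite !lebesgue_rVS; apply: ge0_le_integralT => x.
  exact: lebesgue_rV_ge0.
by apply: IH => v /=; exact: EF.
Qed.

(** * Affine changes of variable on the line *)

Section affine_change_of_variable.
Variable R : realType.
Local Notation mu := (@lebesgue_measure R).

Let affine (c b x : R) : measurableTypeR R := c * x + b.

Lemma measurable_affine c b :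
  measurable_fun [set: measurableTypeR R] (affine c b).
Proof.
apply: measurable_funD; last exact: measurable_cst.
by apply: measurable_funM => //; exact: measurable_cst.
Qed.

(** The scaled pushforward on the left agrees with Lebesgue measure on half-open intervals, hence on
    all measurable sets by uniqueness. *)
Lemma lebesgue_measure_affine (c b : R) (A : set R) : 0 < c ->
  measurable (A : set (measurableTypeR R)) ->
  (c%:E * mu [set x | A (c * x + b)%R])%E = mu A.
Proof.
move=> c0 mA; have c0' : 0 <= c := ltW c0.
pose nu0 : {measure set (measurableTypeR R) -> \bar R} :=
  pushforward mu (affine c b).
pose nu : {measure set (measurableTypeR R) -> \bar R} :=
  mscale (NngNum c0') (nu0 (measurable_affine c b)).
suff -> : mu A = nu A by [].
apply: lebesgue_measure_unique => //= _ [[x y]] _ <-.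
rewrite /nu /nu0 /mscale/= /pushforward.
have -> : affine c b @^-1` [set` `]x, y]%R] =
    [set` `](x - b) / c, (y - b) / c]%R].
  apply/seteqP; split => z /=; rewrite /affine !in_itv/=
    ltr_pdivrMr// ler_pdivlMr// ltrBlDr lerBrDr [z * c]mulrC//.
rewrite !lebesgue_measure_itv/= !lte_fin ltr_pM2r ?invr_gt0// ltrD2r.
case: ifPn => xy; last by rewrite mule0.
by rewrite -EFinM; congr EFin; rewrite -mulrBl mulrC divfK ?gt_eqF//; ring.
Qed.

Lemma integral_affine (c b : R) (f : R -> \bar R) : 0 < c ->
  measurable_fun [set: measurableTypeR R] f -> (forall x, 0 <= f x)%E ->
  (c%:E * \int[mu]_x f (c * x + b)%R = \int[mu]_x f x)%E.
Proof.
move=> c0 mf f0; have c0' : 0 <= c := ltW c0.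
pose nu0 : {measure set (measurableTypeR R) -> \bar R} :=
  pushforward mu (affine c b).
pose nu1 : {measure set (measurableTypeR R) -> \bar R} :=
  nu0 (measurable_affine c b).
pose nu : {measure set (measurableTypeR R) -> \bar R} :=
  mscale (NngNum c0') nu1.
have -> : (\int[mu]_x f x = \int[nu]_x f x)%E.
  apply: eq_measure_integral => A mA _.
  exact: (esym (lebesgue_measure_affine b c0 mA)).
rewrite ge0_integral_mscale//; congr (_ * _)%E.
rewrite /nu1 /nu0/= ge0_integral_pushforward//; exact: measurable_affine.
Qed.

End affine_change_of_variable.

(** * Fubini and scaling in R^n *)

Section fubini_rV.
Variable R : realType.
Local Notation mu := (@lebesgue_measure R).
Local Open Scope ereal_scope.

Lemma measurable_lebesgue_rV_section d (T : measurableType d) n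
    (A : set (T * 'rV[R]_n)) : measurable A ->
  measurable_fun [set: T] (fun t => lebesgue_rV [set v | A (t, v)]).
Proof.
move=> mA.
have := @measurable_fun_xsection _ _ _ _ R (@lebesgue_rV R n) A mA.
congr (measurable_fun _ _); apply/funext => t /=; congr lebesgue_rV.
by apply/seteqP; split => v /=; rewrite /xsection/= inE.
Qed.

(** The two iterated integrals are the two constructions of the product measure; they agree on
    rectangles and therefore coincide. *)
Lemma lebesgue_section_fubini n (A : set (measurableTypeR R * 'rV[R]_n)) :
  measurable A ->
  \int[mu]_x lebesgue_rV [set v | A (x, v)] =
  \int[@lebesgue_rV R n]_v mu [set x | A (x, v)].
Proof.
move=> mA.
have := @product_measure_unique _ _ _ _ R mu (@lebesgue_rV R n)
  (mu \x^ @lebesgue_rV R n) _ A mA.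
rewrite /product_measure1 /product_measure2/= => H.
transitivity (\int[mu]_x ((@lebesgue_rV R n) \o xsection A) x).
  apply: eq_integral => x _ /=; congr lebesgue_rV.
  by apply/seteqP; split => v /=; rewrite /xsection/= inE.
rewrite H.
  apply: eq_integral => v _ /=; congr (lebesgue_measure _).
  by apply/seteqP; split => x /=; rewrite /ysection/= inE.
by move=> B C mB mC; rewrite -product_measure2E.
Qed.

Lemma measurable_insert_section m (j : 'I_m.+1) x (E : set 'rV[R]_m.+1) :
  measurable E -> measurable [set v | E (insert_coord j x v)].
Proof.
move=> mE; have mf : measurable_fun setT (fun v : 'rV[R]_m => insert_coord j x v).
  by apply: measurable_insert_coord => //; exact: measurable_cst.
by rewrite -[X in measurable X]setTI; exact: mf.
Qed.

Lemma measurable_insert_preimage m (j : 'I_m.+1) (E : set 'rV[R]_m.+1) :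
  measurable E ->
  measurable [set z : measurableTypeR R * 'rV[R]_m | E (insert_coord j z.1 z.2)].
Proof.
move=> mE; have mf : measurable_fun setT
    (fun z : measurableTypeR R * 'rV[R]_m => insert_coord j z.1 z.2).
  exact: measurable_insert_coord.
by rewrite -[X in measurable X]setTI; exact: mf.
Qed.

(** Any coordinate may be the outermost one: split off coordinate 0, apply the induction hypothesis
    to its sections, exchange the two integrals by Tonelli and reassemble. *)
Lemma lebesgue_rV_insert m (j : 'I_m.+1) (E : set 'rV[R]_m.+1) : measurable E ->
  lebesgue_rV E = \int[mu]_x lebesgue_rV [set v | E (insert_coord j x v)].
Proof.
elim: m j E => [|m IH] j E mE; first by rewrite (ord1 j) lebesgue_rVS.
have [k ->|->] := unliftP ord0 j; last exact: lebesgue_rVS.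
rewrite lebesgue_rVS.
pose f (z : measurableTypeR R * measurableTypeR R) :=
  lebesgue_rV [set v | E (insert_coord ord0 z.1 (insert_coord k z.2 v))].
have mf : measurable_fun setT f.
  pose h (z : measurableTypeR R * measurableTypeR R * 'rV[R]_m) :=
    insert_coord ord0 z.1.1 (insert_coord k z.1.2 z.2).
  have mh : measurable_fun setT h.
    apply: measurable_insert_coord.
      exact: (measurableT_comp measurable_fst measurable_fst).
    apply: measurable_insert_coord => //.
    exact: (measurableT_comp measurable_snd measurable_fst).
  apply: (@measurable_lebesgue_rV_section _ _ _ (h @^-1` E)).
  by rewrite -[X in measurable X]setTI; exact: mh.
transitivity (\int[mu]_x \int[mu]_y f (x, y)).
  apply: eq_integral => x _; rewrite (IH k)//.
  exact: measurable_insert_section.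
have f0 z : 0 <= f z by exact: lebesgue_rV_ge0.
rewrite (fubini_tonelli f mf f0).
apply: eq_integral => y _; rewrite lebesgue_rVS.
apply: eq_integral => x _; congr lebesgue_rV; apply/seteqP.
by split=> v /=; rewrite insert_coord_lift0.
Qed.

Lemma lebesgue_rV_affine m (c : R) (b : 'rV[R]_m) (E : set 'rV[R]_m) :
  (0 < c)%R -> measurable E ->
  (c ^+ m)%:E * lebesgue_rV [set v | E (c *: v + b)%R] = lebesgue_rV E.
Proof.
move=> c0; elim: m b E => [|m IH] b E mE.
  rewrite expr0 mul1e /=; congr (_%:E); rewrite !indicE; congr (_%:R).
  congr (nat_of_bool _); apply/idP/idP; rewrite !inE/=;
    by rewrite (thinmx0 (c *: 0 + b)%R).
rewrite 2!lebesgue_rVS exprSr EFinM -muleA.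
have mf : measurable_fun [set: measurableTypeR R]
    (fun x : R => lebesgue_rV [set v | E (insert_coord ord0 x v)]).
  exact: (measurable_lebesgue_rV_section (measurable_insert_preimage ord0 mE)).
rewrite -[RHS](@integral_affine R c (b 0 ord0)%R)//.
(* The induction hypothesis rescales the last m coordinates; [integral_affine] then accounts for the
   remaining factor c. *)
have step x : lebesgue_rV [set v | E (c *: insert_coord ord0 x v + b)%R] =
    ((c ^+ m)^-1)%:E * lebesgue_rV
      [set v | E (insert_coord ord0 (c * x + b 0 ord0)%R v)].
  rewrite -[X in _ * X](IH (remove_coord ord0 b)); last exact: measurable_insert_section.
  rewrite muleA -EFinM mulVf ?mul1e; last by rewrite expf_neq0// gt_eqF.
  congr lebesgue_rV; apply/seteqP; split=> v /=; congr E; apply/rowP => i;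
    by rewrite !mxE; case: unliftP => [k ->|->]; rewrite ?mxE.
under eq_integral do rewrite step.
rewrite ge0_integralZl//; last 2 first.
- by have := measurableT_comp mf (measurable_affine c (b 0%R ord0)).
- by rewrite lee_fin invr_ge0 exprn_ge0// ltW.
rewrite [LHS]muleCA; congr (_ * _).
rewrite muleA -EFinM mulfV ?mul1e//.
by rewrite expf_neq0// gt_eqF.
Qed.

End fubini_rV.

Lemma measurable_itv_preimage d (T : measurableType d) (R : realType)
    (f : T -> R) (i : interval R) :
  measurable_fun setT f -> measurable [set x | f x \in i].
Proof.
move=> mf; have := mf measurableT _ (measurable_itv i).
by rewrite setTI.
Qed.

Lemma integral_le_indic d (T : measurableType d) (R : realType)
    (mu : {measure set T -> \bar R}) (J : set T) (f : T -> \bar R) (c : R) :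
  measurable J -> 0 <= c -> (forall x, 0 <= f x)%E ->
  (forall x, J x -> f x <= c%:E)%E -> (forall x, ~ J x -> f x = 0)%E ->
  (\int[mu]_x f x <= c%:E * mu J)%E.
Proof.
move=> mJ c0 f0 fc fJ.
apply: (@le_trans _ _ (\int[mu]_x (c%:E * (\1_J x)%:E))%E).
  apply: ge0_le_integralT => // x; rewrite indicE.
  have [/[!inE] Jx|/negP] := boolP (x \in J); first by rewrite mule1 fc.
  by rewrite inE => /fJ ->; rewrite mule0.
rewrite ge0_integralZl//.
- by rewrite integral_indic// setIT.
- exact: measurableT_comp.
Qed.

Lemma lebesgue_measure_itvcc (R : realType) (a b : R) : a <= b ->
  lebesgue_measure `[a, b]%classic = (b - a)%:E.
Proof.
move=> ab; rewrite lebesgue_measure_itv/= lte_fin; case: ltP => // ba.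
by have /eqP -> : a == b; rewrite ?eq_le ?ab// subrr.
Qed.

Section product_sets.
Variable R : realType.

Lemma lebesgue_rV_product_le m (j : 'I_m.+1) (E : set 'rV[R]_m) (J : set R)
    (e l : R) :
  measurable E -> measurable J -> 0 <= e -> 0 <= l ->
  (lebesgue_rV E <= e%:E)%E -> (lebesgue_measure J <= l%:E)%E ->
  (lebesgue_rV [set v | E (remove_coord j v) /\ J (v 0%R j)] <= (e * l)%:E)%E.
Proof.
move=> mE mJ e0 l0 Ee Jl.
rewrite (lebesgue_rV_insert j); last first.
  apply: measurableI; rewrite -[X in measurable X]setTI.
    exact: measurable_remove_coord.
  exact: (measurable_coord j).
apply: (@le_trans _ _ (e%:E * lebesgue_measure J)%E); last first.
  by rewrite EFinM lee_wpmul2l.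
apply: integral_le_indic => //=.
- move=> x _; apply: le_trans Ee; apply: le_lebesgue_rV => v /=.
  by rewrite insert_coordK => -[].
- move=> x Jx; rewrite (_ : [set _ | _] = set0) ?measure0//.
  by apply/seteqP; split => v //=; rewrite insert_coord_at => -[].
Qed.

Lemma measurable_cube m (r : R) :
  measurable [set v : 'rV[R]_m | forall i, v 0 i \in `[- r, r]].
Proof.
have -> : [set v : 'rV[R]_m | forall i, v 0 i \in `[- r, r]] =
    \bigcap_(i in [set: 'I_m]) [set v | v 0 i \in `[- r, r]].
  by apply/seteqP; split => v /= h i //=; exact: h.
apply: fin_bigcap_measurable; first exact: finite_finset.
by move=> i _; apply: measurable_itv_preimage; exact: measurable_coord.
Qed.

Lemma lebesgue_rV_cube m (r : R) : 0 <= r ->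
  (lebesgue_rV [set v : 'rV[R]_m | forall i, (v 0 i \in `[- r, r])%R] <=
   ((2 * r) ^+ m)%:E)%E.
Proof.
move=> r0; elim: m => [|m IH].
  by rewrite expr0 lee_fin indicE lern1 leq_b1.
rewrite exprSr.
apply: (@le_trans _ _ (lebesgue_rV [set v : 'rV[R]_m.+1 |
    (forall i, remove_coord ord0 v 0 i \in `[- r, r]) /\ `[- r, r]%classic (v 0 ord0)])).
  by apply: le_lebesgue_rV => v /= h; split => // i; rewrite mxE.
apply: (@lebesgue_rV_product_le m ord0 [set v | forall i, v 0 i \in `[- r, r]]) => //.
- exact: measurable_cube.
- by rewrite exprn_ge0// mulr_ge0.
- by rewrite mulr_ge0.
- by rewrite lebesgue_measure_itvcc ?lee_fin; lra.
Qed.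

End product_sets.

(** * Annuli and slabs *)

Section ellipsoids.
Variable R : realType.

Definition dot n (u v : 'rV[R]_n) : R := \sum_i u 0 i * v 0 i.

Lemma dotDr n (u v w : 'rV[R]_n) : dot u (v + w) = dot u v + dot u w.
Proof. by rewrite -big_split; apply: eq_bigr => i _; rewrite mxE mulrDr. Qed.

Lemma dotZr n (u v : 'rV[R]_n) c : dot u (c *: v) = c * dot u v.
Proof. by rewrite mulr_sumr; apply: eq_bigr => i _; rewrite mxE mulrCA. Qed.

Lemma dotC n (u v : 'rV[R]_n) : dot u v = dot v u.
Proof. by apply: eq_bigr => i _; rewrite mulrC. Qed.

Lemma dotNr n (u v : 'rV[R]_n) : dot u (- v) = - dot u v.
Proof. by rewrite -scaleN1r dotZr mulN1r. Qed.

Lemma dotDl n (u v w : 'rV[R]_n) : dot (u + v) w = dot u w + dot v w.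
Proof. by rewrite !(dotC _ w) dotDr. Qed.

Lemma dotZl n (u v : 'rV[R]_n) c : dot (c *: u) v = c * dot u v.
Proof. by rewrite !(dotC _ v) dotZr. Qed.

Lemma dotNl n (u v : 'rV[R]_n) : dot (- u) v = - dot u v.
Proof. by rewrite !(dotC _ v) dotNr. Qed.

Lemma dot_ge0 n (u : 'rV[R]_n) : 0 <= dot u u.
Proof. by apply: sumr_ge0 => i _; rewrite -expr2 sqr_ge0. Qed.

Lemma coord_sqr_le_dot n (u : 'rV[R]_n) i : u 0 i ^+ 2 <= dot u u.
Proof.
rewrite /dot (bigD1 i)//= -expr2 lerDl.
by apply: sumr_ge0 => k _; rewrite -expr2 sqr_ge0.
Qed.

Lemma dot_insert n (j : 'I_n.+1) x (u : 'rV[R]_n.+1) (v : 'rV[R]_n) :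
  dot u (insert_coord j x v) = u 0 j * x + dot (remove_coord j u) v.
Proof.
rewrite /dot (bigD1_ord j)//= insert_coord_at; congr (_ + _).
by apply: eq_bigr => i _; rewrite insert_coord_lift mxE.
Qed.

Lemma dot_insert_self n (j : 'I_n.+1) x (v : 'rV[R]_n) :
  dot (insert_coord j x v) (insert_coord j x v) = x ^+ 2 + dot v v.
Proof. by rewrite dot_insert insert_coord_at insert_coordK expr2. Qed.

Lemma measurable_dot d (T : measurableType d) n (f g : T -> 'rV[R]_n) :
  measurable_fun setT f -> measurable_fun setT g ->
  measurable_fun setT (fun t => dot (f t) (g t)).
Proof.
move=> mf mg; rewrite /dot; elim: index_enum => [|i s IH].
  by under eq_fun do rewrite big_nil; exact: measurable_cst.
under eq_fun do rewrite big_cons.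
apply: measurable_funD => //; apply: measurable_funM.
  exact: (measurableT_comp (measurable_coord i) mf).
exact: (measurableT_comp (measurable_coord i) mg).
Qed.

(** The quadratic form of the matrix 1 + al^T al. It is the value of |X|^2 when one coordinate of X
    equals al . u and the others form u. *)
Definition quadric n (al u : 'rV[R]_n) : R := dot u u + dot al u ^+ 2.

Lemma quadricZ n (al u : 'rV[R]_n) c : quadric al (c *: u) = c ^+ 2 * quadric al u.
Proof. by rewrite /quadric !(dotZl, dotZr); ring. Qed.

Lemma measurable_quadric d (T : measurableType d) n (al : 'rV[R]_n)
    (f : T -> 'rV[R]_n) :
  measurable_fun setT f -> measurable_fun setT (fun t => quadric al (f t)).
Proof.
move=> mf; apply: measurable_funD; first exact: measurable_dot.
by apply: measurable_funX; apply: measurable_dot => //; exact: measurable_cst.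
Qed.

Lemma measurable_rV_affine m (c : R) (b : 'rV[R]_m) :
  measurable_fun setT (fun v : 'rV[R]_m => c *: v + b).
Proof.
apply: measurable_fun_coord => i; under eq_fun do rewrite !mxE.
apply: measurable_funD; last exact: measurable_cst.
by apply: measurable_funM; [exact: measurable_cst|exact: measurable_coord].
Qed.

Lemma measurable_ellipsoid m (al b : 'rV[R]_m) (i : interval R) :
  measurable [set x : 'rV[R]_m | quadric al (x - b) \in i].
Proof.
apply: measurable_itv_preimage; apply: measurable_quadric.
have := measurable_rV_affine 1 (- b).
by under eq_fun do rewrite scale1r.
Qed.

(** The ellipsoid of level w is a translate of the unit one dilated by sqrt w. *)
Lemma lebesgue_rV_ellipsoid m (al b : 'rV[R]_m) (w : R) : 0 < w ->
  (lebesgue_rV [set x | (quadric al (x - b) \in `]-oo, w])%R] =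
  (Num.sqrt w ^+ m)%:E *
    lebesgue_rV [set x | (quadric al (x - 0) \in `]-oo, 1])%R])%E.
Proof.
move=> w0; have s0 : 0 < Num.sqrt w by rewrite sqrtr_gt0.
have c0 : 0 < (Num.sqrt w)^-1 by rewrite invr_gt0.
rewrite -(lebesgue_rV_affine (- ((Num.sqrt w)^-1 *: b)) c0
  (@measurable_ellipsoid m al 0 `]-oo, 1])).
rewrite muleA -EFinM -exprMn mulfV ?gt_eqF// expr1n mul1e.
congr lebesgue_rV; apply/seteqP.
split => x /=; rewrite subr0 -scalerBr quadricZ exprVn sqr_sqrtr ?(ltW w0)//;
  by rewrite !in_itv/= mulrC ler_pdivrMr// mul1r.
Qed.

(** The form dominates |x|^2, so the ellipsoid lies in the cube [-1, 1]^m. The bound is uniform in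
    [al], which will depend on the translation. *)
Lemma lebesgue_rV_unit_ellipsoid m (al : 'rV[R]_m) :
  (lebesgue_rV [set x | (quadric al (x - 0) \in `]-oo, 1])%R] <= (2 ^+ m)%:E)%E.
Proof.
rewrite -[2]mulr1; apply: le_trans (lebesgue_rV_cube m ler01).
apply: le_lebesgue_rV => x /=; rewrite subr0 in_itv/= => q1 i.
have : x 0 i ^+ 2 <= 1.
  apply: le_trans (coord_sqr_le_dot x i) (le_trans _ q1).
  by rewrite lerDl sqr_ge0.
by rewrite in_itv/= -ler_norml -real_normK ?num_real// expr_le1.
Qed.

(** With p and q the square roots of two levels, this makes w^(m/2) Lipschitz in w on bounded
    ranges. The exponent at least 2 is the source of the dimension restriction: sqrt w itself is not
    Lipschitz at 0. *)
Lemma ler_powB_sqr k (s p q : R) : 0 <= p -> p <= q -> q <= s ->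
  q ^+ k.+2 - p ^+ k.+2 <= k.+2%:R * s ^+ k * (q ^+ 2 - p ^+ 2).
Proof.
move=> p0 pq qs; have s0 : 0 <= s by lra.
have D0 : 0 <= q ^+ 2 - p ^+ 2 by nra.
elim: k => [|k IH]; first by rewrite expr0 mulr1; nra.
have -> : q ^+ k.+3 - p ^+ k.+3 =
    q * (q ^+ k.+2 - p ^+ k.+2) + p ^+ k.+1 * (p * (q - p)).
  by rewrite !exprS; ring.
have -> : k.+3%:R * s ^+ k.+1 * (q ^+ 2 - p ^+ 2) =
   s * (k.+2%:R * s ^+ k * (q ^+ 2 - p ^+ 2)) + s ^+ k.+1 * (q ^+ 2 - p ^+ 2).
  by rewrite -natr1 exprS; ring.
apply: lerD; apply: ler_pM => //.
- lra.
- by rewrite subr_ge0 lerXn2r ?nnegrE//; lra.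
- exact: exprn_ge0.
- nra.
- by apply: lerXn2r; rewrite ?nnegrE//; lra.
- nra.
Qed.

Definition annulus_cst (m : nat) (B : R) : R :=
  2 ^+ m * (m%:R * Num.sqrt B ^+ m.-2).

Lemma annulus_cst_ge0 m B : 0 <= annulus_cst m B.
Proof. by rewrite !mulr_ge0 ?exprn_ge0 ?ler0n ?sqrtr_ge0. Qed.

(** The region is a difference of concentric ellipsoids, with measure proportional to w2^(m/2) -
    w1^(m/2) for m = k + 2 when w1 > 0; [ler_powB_sqr] makes this linear in w2 - w1. *)
Lemma lebesgue_rV_annulus k (al b : 'rV[R]_k.+2) (B w1 w2 : R) :
  0 < B -> w2 <= B -> w1 < w2 ->
  (lebesgue_rV [set x | (quadric al (x - b) \in `]w1, w2])%R] <=
  (annulus_cst k.+2 B * (w2 - w1))%:E)%E.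
Proof.
move=> B0 w2B w12.
set L := lebesgue_rV [set x : 'rV[R]_k.+2 | (quadric al (x - 0) \in `]-oo, 1])%R].
have L2 : (L <= (2 ^+ k.+2)%:E)%E := lebesgue_rV_unit_ellipsoid al.
have L0 : (0 <= L)%E := lebesgue_rV_ge0 _.
have Lfin : L \is a fin_num.
  by rewrite ge0_fin_numE//; exact: le_lt_trans L2 (ltry _).
have [l lE] : exists l, L = l%:E by exists (fine L); rewrite fineK.
move: L2 L0; rewrite lE !lee_fin => l2 l0.
have key p q : 0 <= p -> p <= q -> q <= Num.sqrt B ->
    ((q ^+ k.+2 - p ^+ k.+2) * l <= annulus_cst k.+2 B * (q ^+ 2 - p ^+ 2))%R.
  move=> p0 pq qB; rewrite mulrC -[X in (_ <= X)%R]mulrA; apply: ler_pM => //.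
    by rewrite subr_ge0 lerXn2r// nnegrE//; lra.
  exact: ler_powB_sqr.
have [w10|w10] := leP w1 0%R.
  (* Since w1 <= 0, the region lies in the ellipsoid of level w. This level is positive even if w2
     is not, and at most B, as [key] demands. *)
  pose w := Num.min (w2 - w1)%R B.
  have w0 : (0 < w)%R by rewrite lt_min subr_gt0 w12.
  apply: (@le_trans _ _ (lebesgue_rV [set x | (quadric al (x - b) \in `]-oo, w])%R])).
    apply: le_lebesgue_rV => x /=; rewrite !in_itv/= => /andP[_ xw2].
    by rewrite le_min !(le_trans xw2)//; lra.
  rewrite lebesgue_rV_ellipsoid// -/L lE -EFinM lee_fin.
  have := key 0%R (Num.sqrt w) (lexx _) (sqrtr_ge0 _).
  rewrite expr0n/= subr0 ler_wsqrtr ?ge_min ?lexx ?orbT// => /(_ isT) H.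
  apply: le_trans H _; rewrite sqr_sqrtr ?(ltW w0)// expr0n/= subr0.
  by apply: ler_wpM2l; [exact: annulus_cst_ge0|rewrite ge_min lexx].
have w20 : (0 < w2)%R by lra.
have -> : [set x | (quadric al (x - b) \in `]w1, w2])%R] =
    [set x | (quadric al (x - b) \in `]-oo, w2])%R] `\`
    [set x | (quadric al (x - b) \in `]-oo, w1])%R].
  apply/seteqP; split => x /=; rewrite !in_itv/=.
    by move=> /andP[h1 h2]; split=> //; apply/negP; rewrite -ltNge.
  by move=> [h1 /negP]; rewrite -ltNge => h2; rewrite h1 h2.
set E2 := (X in X `\` _); set E1 := (X in _ `\` X).
have -> : (lebesgue_rV (E2 `\` E1) = lebesgue_rV E2 - lebesgue_rV (E2 `&` E1))%E.
  apply: measureD; [exact: measurable_ellipsoid|exact: measurable_ellipsoid|].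
  suff : (lebesgue_rV E2 < +oo)%E by [].
  by rewrite lebesgue_rV_ellipsoid// -/L lE -EFinM ltry.
have -> : E2 `&` E1 = E1.
  by apply/setIidPr => x; rewrite /E1 /E2/= !in_itv/= => /le_trans; apply; exact: ltW.
have EL w : (0 < w)%R -> lebesgue_rV [set x | (quadric al (x - b) \in `]-oo, w])%R] =
    (Num.sqrt w ^+ k.+2 * l)%:E.
  by move=> w0; rewrite lebesgue_rV_ellipsoid// -/L lE EFinM.
rewrite (EL _ w20) (EL _ w10) -EFinB lee_fin -mulrBl.
have := key (Num.sqrt w1) (Num.sqrt w2) (sqrtr_ge0 _) (ler_wsqrtr (ltW w12))
  (ler_wsqrtr w2B).
by rewrite (sqr_sqrtr (ltW w10)) (sqr_sqrtr (ltW w20)).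
Qed.

End ellipsoids.

Section slabs.
Variable R : realType.
Local Notation mu := (@lebesgue_measure R).

(** The left side, as a function of x, has its minimum z^2 / (1 + |al|^2) at the displayed centre,
    so its level sets are concentric ellipsoids. *)
Lemma complete_square n (al x : 'rV[R]_n) (z : R) :
  (z + dot al x) ^+ 2 + dot x x =
  quadric al (x - (- (z / (1 + dot al al)) *: al)) + z ^+ 2 / (1 + dot al al).
Proof.
have a0 := dot_ge0 al; have s0 : 1 + dot al al != 0 by rewrite gt_eqF//; lra.
rewrite /quadric scaleNr opprK.
rewrite !(dotDl, dotZl, dotDr, dotZr) (dotC x al).
set p := dot al x; set a := dot al al; set q := dot x x; field.
exact: s0.
Qed.

Lemma lebesgue_rV_quadratic k (al : 'rV[R]_k.+2) (z B w1 w2 : R) :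
  0 < B -> w2 <= B -> w1 < w2 ->
  (lebesgue_rV [set x | ((z + dot al x) ^+ 2 + dot x x \in `]w1, w2])%R] <=
  (annulus_cst k.+2 B * (w2 - w1))%:E)%E.
Proof.
(* Both levels drop by c >= 0: the width is kept and the upper level stays at most B. *)
move=> B0 w2B w12; set c := z ^+ 2 / (1 + dot al al).
have c0 : 0 <= c by rewrite divr_ge0 ?sqr_ge0// addr_ge0// dot_ge0.
have -> : w2 - w1 = (w2 - c) - (w1 - c) by ring.
apply: le_trans (lebesgue_rV_annulus al (- (z / (1 + dot al al)) *: al) B0 _ _);
  [|lra|lra].
apply: le_lebesgue_rV => x /=; rewrite complete_square -/c !in_itv/=; lra.
Qed.

Lemma measurable_dot_itv n (T : 'rV[R]_n) (i : interval R) :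
  measurable [set x | dot T x \in i].
Proof.
by apply: measurable_itv_preimage; apply: measurable_dot => //; exact: measurable_cst.
Qed.

Lemma measurable_sqnorm_itv n (i : interval R) :
  measurable [set x : 'rV[R]_n | dot x x \in i].
Proof. by apply: measurable_itv_preimage; exact: measurable_dot. Qed.

Lemma lebesgue_rV_shell k (B w1 w2 : R) :
  0 < B -> w2 <= B -> w1 < w2 ->
  (lebesgue_rV [set x : 'rV[R]_k.+2 | (dot x x \in `]w1, w2])%R] <=
  (annulus_cst k.+2 B * (w2 - w1))%:E)%E.
Proof.
move=> B0 w2B w12.
apply: le_trans (lebesgue_rV_quadratic (0 : 'rV[R]_k.+2) 0 B0 w2B w12).
apply: le_lebesgue_rV => x /=.
rewrite (_ : dot 0 x = 0) ?addr0 ?expr0n ?add0r//.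
by rewrite /dot big1// => i _; rewrite mxE mul0r.
Qed.

Lemma lebesgue_measure_mul_itv (t z1 z2 : R) : t != 0 -> z1 <= z2 ->
  (mu [set z | (t * z \in `[z1, z2])%R] <= ((z2 - z1) / `|t|)%:E)%E.
Proof.
move=> t0 z12.
have [a [b [ab E ->]]] : exists a b, [/\ a <= b,
    [set z | t * z \in `[z1, z2]] `<=` `[a, b]%classic & (z2 - z1) / `|t| = b - a].
  have [tp|tn] := ltP 0 t.
    exists (z1 / t), (z2 / t); split.
    - by rewrite ler_pM2r ?invr_gt0.
    - by move=> z /=; rewrite !in_itv/= ler_pdivrMr// ler_pdivlMr// mulrC.
    - by rewrite gtr0_norm// mulrBl.
  have {tn} t0' : t < 0 by rewrite lt_neqAle t0.
  exists (z2 / t), (z1 / t); split.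
  - by rewrite ler_nM2r ?invr_lt0.
  - by move=> z /=; rewrite !in_itv/= ler_ndivrMr// ler_ndivlMr// mulrC andbC.
  - by rewrite ltr0_norm// invrN mulrN mulrBl opprB.
rewrite -(lebesgue_measure_itvcc ab); apply: le_measure => //; rewrite inE.
  apply: (@measurable_itv_preimage _ (measurableTypeR R)).
  by apply: measurable_funM => //; exact: measurable_cst.
exact: measurable_itv.
Qed.

(* The j-th coordinate is replaced by z with T . X = T_j z, a shear; for fixed
   z the remaining k + 2 >= 2 variables lie between two concentric ellipsoids. *)
Lemma lebesgue_rV_slab k (T : 'rV[R]_k.+3) (j : 'I_k.+3) (B w1 w2 z1 z2 : R) :
  T 0 j != 0 -> 0 < B -> w2 <= B -> w1 < w2 -> z1 <= z2 ->
  (lebesgue_rV [set x | (dot x x \in `]w1, w2] /\ dot T x \in `[z1, z2])%R] <=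
  (annulus_cst k.+2 B * (w2 - w1) * ((z2 - z1) / `|T 0%R j|))%:E)%E.
Proof.
move=> Tj B0 w2B w12 z12.
set E := [set x | _].
have mE : measurable E.
  by apply: measurableI; [exact: measurable_sqnorm_itv|exact: measurable_dot_itv].
(* Chosen so that the remaining coordinates cancel in T . X once x_j = z + al . v, leaving T_j z. *)
pose al := - (T 0 j)^-1 *: remove_coord j T.
have C0 : 0 <= annulus_cst k.+2 B * (w2 - w1).
  by rewrite mulr_ge0 ?annulus_cst_ge0//; lra.
have mF : measurable [set z : measurableTypeR R * 'rV[R]_k.+2 |
    E (insert_coord j (z.1 + dot al z.2) z.2)].
  have mf : measurable_fun setT (fun z : measurableTypeR R * 'rV[R]_k.+2 =>
      insert_coord j (z.1 + dot al z.2) z.2).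
    apply: measurable_insert_coord => //; apply: measurable_funD => //.
    by apply: measurable_dot => //; exact: measurable_cst.
  by rewrite -[X in measurable X]setTI; exact: mf.
rewrite (lebesgue_rV_insert j mE).
(* The shear is performed by making x_j the inner variable, translating it by al . v for each fixed
   v, and exchanging the integrals back. *)
rewrite (lebesgue_section_fubini (measurable_insert_preimage j mE)).
rewrite (eq_integral (fun v : 'rV[R]_k.+2 =>
    mu [set x | E (insert_coord j (x + dot al v)%R v)])); last first.
  move=> v _ /=.
  have mEv : measurable ([set x | E (insert_coord j x v)] : set (measurableTypeR R)).
    have mf : measurable_fun setT (fun x : measurableTypeR R => insert_coord j x v).
      by apply: measurable_insert_coord => //; exact: measurable_cst.
    by rewrite -[X in measurable X]setTI; exact: mf.
  rewrite -(lebesgue_measure_affine (dot al v) ltr01 mEv) mul1e.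
  by congr (mu _); apply/seteqP; split=> x /=; rewrite mul1r.
rewrite -(lebesgue_section_fubini mF).
have TjE z v : dot T (insert_coord j (z + dot al v) v) = T 0 j * z.
  rewrite dot_insert /al dotC dotZr (dotC v) mulrDr mulrA mulrN mulfV// mulN1r.
  by rewrite addrNK.
pose J := [set z : R | T 0 j * z \in `[z1, z2]].
(* Sections are empty unless z lies in J, and each one satisfies the annulus bound. *)
apply: (@le_trans _ _ ((annulus_cst k.+2 B * (w2 - w1))%:E * mu J)%E).
  apply: integral_le_indic => //.
  - apply: measurable_itv_preimage.
    by apply: measurable_funM => //; exact: measurable_cst.
  - move=> z _; apply: le_trans (lebesgue_rV_quadratic al z B0 w2B w12).
    by apply: le_lebesgue_rV => v /= []; rewrite dot_insert_self.
  - move=> z Jz.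
    rewrite (_ : [set v | _] = set0); first exact: (measure0 (@lebesgue_rV R k.+2)).
    by apply/seteqP; split => v //= []; rewrite TjE.
by rewrite [leRHS]EFinM lee_wpmul2l//; exact: lebesgue_measure_mul_itv.
Qed.

End slabs.

(** * Covering the intersection by slices *)

Section enorm.
Variable R : realType.

Lemma enorm_ge0 n (x : 'rV[R]_n) : 0 <= enorm x.
Proof. exact: sqrtr_ge0. Qed.

Lemma sqr_enorm n (x : 'rV[R]_n) : enorm x ^+ 2 = dot x x.
Proof.
have -> : dot x x = \sum_i x 0 i ^+ 2 by apply: eq_bigr => i _; rewrite expr2.
by rewrite sqr_sqrtr// sumr_ge0// => i _; rewrite sqr_ge0.
Qed.

Lemma enorm_sqr_le m n (x : 'rV[R]_m) (y : 'rV[R]_n) :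
  dot x x <= dot y y -> enorm x <= enorm y.
Proof.
by rewrite -!sqr_enorm => h; rewrite -(@ler_pXn2r _ 2)// nnegrE enorm_ge0.
Qed.

(** Cauchy-Schwarz, from the nonnegativity of the squared length of |y|^2 x - (x . y) y. *)
Lemma dot_le_enorm n (x y : 'rV[R]_n) : dot x y <= enorm x * enorm y.
Proof.
have [y0|yn0] := eqVneq (dot y y) 0.
  have yi i : y 0 i = 0.
    have := coord_sqr_le_dot y i; rewrite y0 => h.
    by apply/eqP; rewrite -sqrf_eq0 eq_le h sqr_ge0.
  rewrite /dot big1 => [|i _]; last by rewrite yi mulr0.
  by rewrite mulr_ge0 ?enorm_ge0.
have yy : 0 < dot y y by rewrite lt_neqAle eq_sym yn0 dot_ge0.
have H := dot_ge0 (dot y y *: x - dot x y *: y).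
have {H} : 0 <= dot y y * (dot x x * dot y y - dot x y ^+ 2).
  move: H; rewrite !(dotDl, dotNl, dotZl, dotDr, dotNr, dotZr) (dotC y x).
  by congr (_ <= _); ring.
rewrite pmulr_rge0// subr_ge0 -!sqr_enorm -exprMn => h.
have [d0|d0] := leP (dot x y) 0.
  by apply: le_trans d0 _; rewrite mulr_ge0 ?enorm_ge0.
by rewrite -(@ler_pXn2r _ 2)// nnegrE ?mulr_ge0 ?enorm_ge0// ltW.
Qed.

Lemma enormD n (x y : 'rV[R]_n) : enorm (x + y) <= enorm x + enorm y.
Proof.
rewrite -(@ler_pXn2r _ 2)// ?nnegrE ?addr_ge0 ?enorm_ge0//.
rewrite sqr_enorm !(dotDl, dotDr) (dotC y x) -!sqr_enorm.
have := dot_le_enorm x y; lra.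
Qed.

Lemma enormN n (x : 'rV[R]_n) : enorm (- x) = enorm x.
Proof. by congr Num.sqrt; apply: eq_bigr => i _; rewrite mxE sqrrN. Qed.

Lemma enorm_dist n (x y : 'rV[R]_n) : `|enorm x - enorm y| <= enorm (x - y).
Proof.
have h1 : enorm x <= enorm (x - y) + enorm y.
  by rewrite -{1}(subrK y x); exact: enormD.
have h2 : enorm y <= enorm (x - y) + enorm x.
  by rewrite -(enormN (x - y)) opprB -{1}(subrK x y); exact: enormD.
by rewrite ler_norml; lra.
Qed.

Lemma enorm_remove n (j : 'I_n.+1) (v : 'rV[R]_n.+1) :
  enorm (remove_coord j v) <= enorm v.
Proof.
apply: enorm_sqr_le; rewrite -[in leRHS](remove_coordK j v) dot_insert_self.
by rewrite lerDr sqr_ge0.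
Qed.

Lemma norm_coord_le n (j : 'I_n) (v : 'rV[R]_n) : `|v 0 j| <= enorm v.
Proof.
rewrite -(@ler_pXn2r _ 2)// ?nnegrE ?enorm_ge0//.
by rewrite real_normK ?num_real// sqr_enorm coord_sqr_le_dot.
Qed.

(** Taking a largest coordinate lets the factor 1 / |T_j| of the slab estimate be replaced by n /
    |T|. *)
Lemma enorm_le_max n (T : 'rV[R]_n) : 0 < enorm T ->
  exists j, enorm T <= n%:R * `|T 0 j|.
Proof.
case: n T => [|n] T T0.
  by move: T0; rewrite /enorm big_ord0 sqrtr0 ltxx.
pose j := [arg max_(i > ord0) `|T 0 i|]%O.
have jmax i : `|T 0 i| <= `|T 0 j| by rewrite /j; case: arg_maxP => // k _; apply.
exists j; rewrite -(@ler_pXn2r _ 2)// ?nnegrE ?enorm_ge0 ?mulr_ge0//.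
rewrite sqr_enorm /dot exprMn.
apply: (@le_trans _ _ (\sum_(i < n.+1) `|T 0 j| ^+ 2)).
  apply: ler_sum => i _; rewrite -expr2 -real_normK ?num_real//.
  by rewrite ler_pXn2r ?nnegrE.
rewrite sumr_const card_ord -[leLHS]mulr_natl ler_wpM2r ?sqr_ge0//.
by rewrite -natrX ler_nat leq_pmulr.
Qed.

End enorm.

Section covering.
Variable R : realType.

Lemma lebesgue_rV_cover n (S : set 'rV[R]_n) (E : nat -> set 'rV[R]_n) M (b : R) :
  (forall i, measurable (E i)) -> (forall i, lebesgue_rV (E i) <= b%:E)%E ->
  (forall v, S v -> exists2 i, (i < M)%N & E i v) ->
  (lebesgue_rV S <= (M%:R * b)%:E)%E.
Proof.
move=> mE Eb SE.
apply: (@le_trans _ _ (lebesgue_rV (\big[setU/set0]_(i < M) E i))).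
  apply: le_lebesgue_rV => v /SE[i iM Ei].
  by rewrite -bigcup_mkord; exists i.
apply: (@le_trans _ _ (\sum_(i < M) lebesgue_rV (E i))%E).
  exact: (@Boole_inequality _ _ _ (@lebesgue_rV R n)).
apply: (@le_trans _ _ (\sum_(i < M) b%:E)%E); first by apply: lee_sum => i _.
by rewrite sumEFin lee_fin sumr_const card_ord mulr_natl.
Qed.

(** Here [Q v r] says that r is an admissible radius for v. The range [p - l, p + l] of radii is cut
    into pieces of length d, each costing b. *)
Lemma lebesgue_rV_slices n (S : set 'rV[R]_n) (Q : 'rV[R]_n -> R -> Prop)
    (p l d b : R) :
  0 < d -> 0 <= l -> 0 <= b ->
  (forall v, S v -> exists2 r, Q v r & `|r - p| <= l) ->
  (forall c, exists E, [/\ measurable E, (lebesgue_rV E <= b%:E)%E &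
    forall v r, S v -> Q v r -> c <= r <= c + d -> E v]) ->
  (lebesgue_rV S <= ((2 * l / d + 1) * b)%:E)%E.
Proof.
move=> d0 l0 b0 SQ /choice[E EP].
(* The successor leaves room for the piece starting at the integer part of 2 l / d, which contains
   the right end of the range. *)
pose M := (Num.truncn (2 * l / d)).+1.
apply: (@le_trans _ _ (M%:R * b)%:E).
  apply: (@lebesgue_rV_cover _ _ (fun i => E (p - l + i%:R * d))).
  - by move=> i; have [] := EP (p - l + i%:R * d).
  - by move=> i; have [] := EP (p - l + i%:R * d).
  move=> v Sv; have [r Qr rp] := SQ v Sv.
  pose x := r - (p - l).
  have [x0 x2] : 0 <= x /\ x <= 2 * l by move: rp; rewrite /x ler_norml; lra.
  exists (Num.truncn (x / d)).
    by rewrite ltnS le_truncn// ler_pM2r ?invr_gt0.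
  have [_ _] := EP (p - l + (Num.truncn (x / d))%:R * d).
  apply; [exact: Sv|exact: Qr|].
  have /andP[h1 h2] : (Num.truncn (x / d))%:R <= x / d < (Num.truncn (x / d)).+1%:R.
    by apply: truncn_itv; rewrite divr_ge0// ltW.
  move: h1 h2; rewrite ler_pdivlMr// ltr_pdivrMr// -natr1 /x.
  lra.
rewrite lee_fin ler_wpM2r// /M -natr1 lerD2r truncn_le.
by rewrite divr_ge0 ?mulr_ge0// ltW.
Qed.

End covering.

(** * Radii attached to points of the intersection *)

Section tubes.
Variable R : realType.

Lemma measurable_tube n (E : set 'rV[R]_n) (i : interval R) : measurable E ->
  measurable [set v : 'rV[R]_n.+1 |
    E (remove_coord ord_max v) /\ v 0 ord_max \in i].
Proof.
move=> mE; apply: measurableI.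
  by rewrite -[X in measurable X]setTI; exact: measurable_remove_coord.
by apply: measurable_itv_preimage; exact: measurable_coord.
Qed.

Lemma remove_coordD n (j : 'I_n.+1) (u v : 'rV[R]_n.+1) :
  remove_coord j (u + v) = remove_coord j u + remove_coord j v.
Proof. by apply/rowP => i; rewrite !mxE. Qed.

Definition witness n (J : set R) (g : R -> R -> R) (a abar d : R)
    (tau v : 'rV[R]_n.+1) (r s : R) : Prop :=
  [/\ J r /\ J s,
      `|enorm (remove_coord ord_max v) - r| <= d,
      `|enorm (remove_coord ord_max v - remove_coord ord_max tau) - s| <= d,
      `|v 0 ord_max - g abar r| <= d &
      `|v 0 ord_max - tau 0 ord_max - g a s| <= d].

Lemma neighbourhood_Gamma n (J : set R) (g : R -> R -> R) (a d : R)
    (v : 'rV[R]_n.+1) : neighbourhood (Gamma J g a) d v ->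
  exists r, [/\ J r, `|enorm (remove_coord ord_max v) - r| <= d &
    `|v 0 ord_max - g a r| <= d].
Proof.
move=> [x [y [[X /= JX <-] [yd ->]]]].
exists (enorm X); split => //.
  rewrite remove_coordD insert_coordK.
  apply: le_trans (enorm_dist _ _) _.
  rewrite addrAC subrr add0r; exact: le_trans (enorm_remove _ _) (ltW yd).
rewrite mxE (insert_coord_at ord_max _ X) addrAC subrr add0r.
exact: le_trans (norm_coord_le _ _) (ltW yd).
Qed.

Lemma intersection_witness n (J : set R) (g : R -> R -> R) (a abar d : R)
    (tau v : 'rV[R]_n.+1) :
  (translate (neighbourhood (Gamma J g a) d) tau `&`
   neighbourhood (Gamma J g abar) d) v ->
  exists r s, witness J g a abar d tau v r s.
Proof.
move=> [[u /neighbourhood_Gamma[s [Js us ugs]] <-] /neighbourhood_Gamma[r [Jr]]].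
move=> h1 h2; exists r, s; split => //.
  by rewrite remove_coordD addrK.
by rewrite mxE addrK.
Qed.

End tubes.

(** * The measure of one slice *)

Section slice.
Variable R : realType.

(* On a slice |X|^2 ranges over an interval of length 21 d, y over one of length
   2 (2 + K) d, and X . T over one of length (15 + 5 (4 + K) / m) d. *)
Definition tube_cst1 (k : nat) (K : R) : R :=
  annulus_cst k.+3 9 * 42 * (2 + K).

Definition tube_cst2 (k : nat) (K m : R) : R :=
  annulus_cst k.+2 9 * 42 * (2 + K) * (15 + 5 * ((4 + K) / m)) * k.+3%:R.

Lemma tube_cst1_ge0 k K : 0 <= K -> 0 <= tube_cst1 k K.
Proof.
move=> K0; rewrite /tube_cst1; have := annulus_cst_ge0 k.+3 (9 : R).
move: (annulus_cst _ _) => C C0.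
by apply: mulr_ge0; [rewrite mulr_ge0|lra].
Qed.

Lemma tube_cst2_ge0 k K m : 0 <= K -> 0 <= m -> 0 <= tube_cst2 k K m.
Proof.
move=> K0 m0; rewrite /tube_cst2; have := annulus_cst_ge0 k.+2 (9 : R).
move: (annulus_cst _ _) => C C0.
have ? : 0 <= (4 + K) / m by rewrite divr_ge0//; lra.
apply: mulr_ge0 => //; apply: mulr_ge0; last by lra.
by apply: mulr_ge0; [rewrite mulr_ge0|lra].
Qed.

Variables (k : nat) (J : set R) (g : R -> R -> R) (a abar d K m : R).
Variable (tau : 'rV[R]_k.+4).
Hypothesis J12 : forall r, J r -> 1 <= r <= 2.
Hypothesis d01 : 0 < d < 1.
Hypothesis K0 : 0 <= K.
Hypothesis m0 : 0 < m.
Hypothesis lip_abar :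
  forall r s, J r -> J s -> `|g abar r - g abar s| <= K * `|r - s|.
Hypothesis exp_a : forall r s, J r -> J s -> m * `|r - s| <= `|g a r - g a s|.

Local Notation T := (remove_coord ord_max tau).
Local Notation S := (translate (neighbourhood (Gamma J g a) d) tau `&`
  neighbourhood (Gamma J g abar) d).
Local Notation wit := (witness J g a abar d tau).

Let normsqr_diff (x r e : R) : 0 <= x <= 3 -> 1 <= r <= 2 -> `|x - r| <= e ->
  `|x ^+ 2 - r ^+ 2| <= 5 * e.
Proof.
move=> x3 r2 xr.
have -> : x ^+ 2 - r ^+ 2 = (x + r) * (x - r) by ring.
by rewrite normrM ler_pM// ger0_norm; lra.
Qed.

(** One witness in the slice is fixed as a reference, and all others are compared with it. One set E
    carries both bounds: the first forgets the condition on T . X, the second uses it. A slice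
    without witnesses is covered by the empty set. *)
Lemma slice_tube (c : R) : exists E : set 'rV[R]_k.+4,
  [/\ measurable E, (lebesgue_rV E <= (tube_cst1 k K * d ^+ 2)%:E)%E,
    0 < enorm T -> (lebesgue_rV E <= (tube_cst2 k K m * d ^+ 3 / enorm T)%:E)%E &
    forall v r s, wit v r s -> c <= r <= c + d -> E v].
Proof.
have [d0 d1] := andP d01.
have [[v0 [r0 [s0 [w0 r0c]]]]|none] :=
    pselect (exists v r s, wit v r s /\ c <= r <= c + d); last first.
  exists set0; split => //.
  - rewrite (measure0 (@lebesgue_rV R k.+4)) lee_fin.
    by apply: mulr_ge0; [exact: tube_cst1_ge0|rewrite exprn_ge0// ltW].
  - move=> T0; rewrite (measure0 (@lebesgue_rV R k.+4)) lee_fin.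
    apply: mulr_ge0; last by rewrite invr_ge0 ltW.
    apply: mulr_ge0; last by rewrite exprn_ge0// ltW.
    by apply: tube_cst2_ge0 => //; exact: ltW.
  - by move=> v r s w rc; apply: none; exists v, r, s.
have [[Jr0 Js0] _ _] := w0; move: (v0 0 ord_max) => y0 h3 h4 {w0}.
(* [sg * d] will bound the variation of s: g a s varies by at most (4 + K) d, and g a expands
   distances by at least m. *)
pose sg := (4 + K) / m.
have Kp := K0; have mp' := m0.
have K4 : 0 <= 4 + K by lra.
have K2 : 0 <= 2 + K by lra.
have dp : 0 <= d by lra.
have mp : 0 <= m by lra.
have sg0 : 0 <= sg by rewrite divr_ge0.
(* |X| is within 2 d of r0 and |X| + r0 <= 5, so |X|^2 is within 10 d of r0^2. The 11 makes room for
   the open left end; the cap 9 is legitimate because |X| <= 2 + d <= 3. *)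
pose w1 := r0 ^+ 2 - 11 * d; pose w2 := Num.min (r0 ^+ 2 + 10 * d) 9.
(* Centre and half-width for T . X, read off from 2 T . X = |X|^2 - |X - T|^2 + |T|^2, where the
   first two terms deviate from r0^2 and s0^2 by at most 10 d and 5 (1 + sg) d. *)
pose zc := (r0 ^+ 2 - s0 ^+ 2 + dot T T) / 2.
pose zr := (10 * d + 5 * ((1 + sg) * d)) / 2.
pose y1 := y0 - (2 + K) * d; pose y2 := y0 + (2 + K) * d.
have r02 := J12 Jr0.
have w29 : w2 <= 9 by rewrite ge_min lexx orbT.
have w12 : w1 < w2 by rewrite lt_min /w1; apply/andP; split; nra.
have w21 : w2 - w1 <= 21 * d.
  have : w2 <= r0 ^+ 2 + 10 * d by rewrite ge_min lexx.
  by rewrite /w1; lra.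
have Kd : 0 <= (2 + K) * d by rewrite mulr_ge0.
have y12 : y1 <= y2 by rewrite /y1 /y2; lra.
have zr0 : 0 <= zr.
  have sg1 : 0 <= 1 + sg by lra.
  have : 0 <= (1 + sg) * d by rewrite mulr_ge0.
  by rewrite /zr; lra.
pose E0 := [set X : 'rV[R]_k.+3 |
  dot X X \in `]w1, w2] /\ dot T X \in `[zc - zr, zc + zr]].
have mE0 : measurable E0.
  by apply: measurableI; [exact: measurable_sqnorm_itv|exact: measurable_dot_itv].
pose E := [set v : 'rV[R]_k.+4 |
  E0 (remove_coord ord_max v) /\ `[y1, y2]%classic (v 0 ord_max)].
have tube_le (e : R) : 0 <= e -> (lebesgue_rV E0 <= e%:E)%E ->
    (lebesgue_rV E <= (e * (2 * ((2 + K) * d)))%:E)%E.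
  move=> e0 E0e; apply: lebesgue_rV_product_le => //.
    by rewrite mulr_ge0.
  by rewrite lebesgue_measure_itvcc// lee_fin /y1 /y2; lra.
exists E; split.
- exact: measurable_tube.
- have := lebesgue_rV_shell k.+1 (ltr0n R 9) w29 w12.
  have := annulus_cst_ge0 k.+3 (9 : R); rewrite /tube_cst1.
  move: (annulus_cst _ _) => C C0 shellP.
  apply: le_trans (tube_le (C * (21 * d)) _ _) _.
  + by apply: mulr_ge0 => //; lra.
  + apply: (@le_trans _ _ (C * (w2 - w1))%:E).
      by apply: le_trans shellP; apply: le_lebesgue_rV => X [].
    by rewrite lee_fin ler_wpM2l.
  + by rewrite lee_fin le_eqVlt; apply/orP; left; apply/eqP; ring.
- move=> T0; have [j Tj] := enorm_le_max T0.
  have Tj0 : 0 < `|T 0 j|.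
    by move: (lt_le_trans T0 Tj); rewrite pmulr_rgt0.
  have Tj1 : `|T 0 j|^-1 <= k.+3%:R / enorm T.
    by rewrite ler_pdivlMr// mulrC ler_pdivrMr.
  have zz : zc - zr <= zc + zr by lra.
  have Tjn : T 0 j != 0 by rewrite -normr_gt0.
  have := lebesgue_rV_slab Tjn (ltr0n R 9) w29 w12 zz.
  have := annulus_cst_ge0 k.+2 (9 : R); rewrite /tube_cst2 -/sg.
  move: (annulus_cst _ _) => C C0 slabP.
  apply: le_trans (tube_le (C * (21 * d) * (2 * zr * (k.+3%:R / enorm T))) _ _) _.
  + apply: mulr_ge0; first by apply: mulr_ge0 => //; lra.
    by apply: mulr_ge0; [lra|rewrite divr_ge0// ltW].
  + apply: le_trans slabP _; rewrite lee_fin; apply: ler_pM.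
    * by rewrite mulr_ge0//; lra.
    * by rewrite mulr_ge0 ?invr_ge0//; lra.
    * by rewrite ler_wpM2l.
    * by apply: ler_pM => //; lra.
  + rewrite lee_fin /zr le_eqVlt; apply/orP; left; apply/eqP.
    by field; rewrite gt_eqF.
move=> v r s [[Jr Js] q1 q2 q3 q4] rc.
rewrite /E /E0/= !in_itv/=.
move: (remove_coord ord_max v) (v 0 ord_max) q1 q2 q3 q4 => X y q1 q2 q3 q4.
have r12 := J12 Jr; have s12 := J12 Js; have s02 := J12 Js0.
have rr0 : `|r - r0| <= d by rewrite ler_norml; lra.
have grr0 : `|g abar r - g abar r0| <= K * d.
  by apply: le_trans (lip_abar Jr Jr0) _; rewrite ler_wpM2l.
(* Passing through g abar r and g abar r0 costs d + K d + d. *)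
have yy0 : `|y - y0| <= (2 + K) * d.
  by move: q3 h3 grr0; rewrite !ler_norml; lra.
have ss0 : `|s - s0| <= sg * d.
  rewrite /sg mulrAC ler_pdivlMr// mulrC; apply: le_trans (exp_a Js Js0) _.
  by move: q4 h4 yy0; rewrite !ler_norml; lra.
have X0 := enorm_ge0 X; have XT0 := enorm_ge0 (X - T).
have xr0 : `|enorm X ^+ 2 - r0 ^+ 2| <= 5 * (2 * d).
  apply: normsqr_diff => //.
    by move: q1; rewrite ler_norml; lra.
  by move: q1 rr0; rewrite !ler_norml; lra.
have xs0 : `|enorm (X - T) ^+ 2 - s0 ^+ 2| <= 5 * ((1 + sg) * d).
  apply: normsqr_diff => //.
    by move: q2; rewrite ler_norml; lra.
  by move: q2 ss0; rewrite !ler_norml; lra.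
have x9 : enorm X ^+ 2 <= 9.
  by move: q1; rewrite ler_norml => q1; nra.
rewrite /y1 /y2.
have XTE : dot T X = (enorm X ^+ 2 - enorm (X - T) ^+ 2 + dot T T) / 2.
  rewrite !sqr_enorm !(dotDl, dotNl, dotDr, dotNr) (dotC X T).
  by field.
move: yy0 xr0 xs0; rewrite !ler_norml => yy0 xr0 xs0.
split; last by lra.
split; last by rewrite XTE /zc /zr; lra.
rewrite -sqr_enorm le_min x9 andbT /w1; lra.
Qed.

End slice.

(** * Summing over the slices *)

Section intersection_bound.
Variable R : realType.

(** All radii lie in [1, 2], so at most 1 / d + 1 slices of measure O(d^2) suffice. *)
Lemma intersection_le (k : nat) (J : set R) (g : R -> R -> R) (a abar d K m : R)
    (tau : 'rV[R]_k.+4) :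
  (forall r, J r -> 1 <= r <= 2) -> 0 < d < 1 -> 0 <= K -> 0 < m ->
  (forall r s, J r -> J s -> `|g abar r - g abar s| <= K * `|r - s|) ->
  (forall r s, J r -> J s -> m * `|r - s| <= `|g a r - g a s|) ->
  (lebesgue_rV (translate (neighbourhood (Gamma J g a) d) tau `&`
     neighbourhood (Gamma J g abar) d) <= (3 * tube_cst1 k K * d)%:E)%E.
Proof.
move=> J12 d01 K0 m0 lip_abar exp_a; set S := (X in lebesgue_rV X).
have /andP[d0 d1] := d01; have dn0 : d != 0 by rewrite gt_eqF.
have c0 := tube_cst1_ge0 k K0.
have H := slice_tube tau J12 d01 K0 m0 lip_abar exp_a.
move: c0 H; move: (tube_cst1 k K) => c1 c0 H.
have cd0 : 0 <= c1 * d ^+ 2 by rewrite mulr_ge0// sqr_ge0.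
have := @lebesgue_rV_slices R _ S
  (fun v r => exists s, witness J g a abar d tau v r s) (3 / 2) (1 / 2) d
  (c1 * d ^+ 2) d0.
move=> /(_ _ cd0) slices; apply: le_trans (slices _ _ _) _.
- by lra.
- move=> v /intersection_witness[r [s w]]; exists r; first by exists s.
  by have [[Jr _] _ _ _ _] := w; have := J12 _ Jr; rewrite ler_norml; lra.
- move=> c; have [E [mE E1 _ EP]] := H c; exists E; split => // v r _ [s w].
  exact: EP w.
rewrite lee_fin.
have -> : (2 * (1 / 2) / d + 1) * (c1 * d ^+ 2) = c1 * d + c1 * d * d by field.
have : 0 <= c1 * d by rewrite mulr_ge0// ltW.
nra.
Qed.

Lemma intersection_le_separated (k : nat) (J : set R) (g : R -> R -> R)
    (a abar d K m L : R) (tau : 'rV[R]_k.+4) :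
  (forall r, J r -> 1 <= r <= 2) -> 0 < d < 1 -> 0 <= K -> 0 < m -> 0 < L ->
  (forall r s, J r -> J s -> `|g a r - g a s| <= K * `|r - s|) ->
  (forall r s, J r -> J s -> `|g abar r - g abar s| <= K * `|r - s|) ->
  (forall r s, J r -> J s -> m * `|r - s| <= `|g a r - g a s|) ->
  (forall r s, J r -> J s ->
    L * `|r - s| <= `|(g abar r - g a r) - (g abar s - g a s)|) ->
  (lebesgue_rV (translate (neighbourhood (Gamma J g a) d) tau `&`
     neighbourhood (Gamma J g abar) d) <=
   (((8 + 12 * K) / L + 1) * (tube_cst1 k K + tube_cst2 k K m) * d ^+ 2)%:E)%E.
Proof.
move=> J12 d01 K0 m0 L0 lip_a lip_abar exp_a exp_L; set S := (X in lebesgue_rV X).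
have /andP[d0 d1] := d01; have dn0 : d != 0 by rewrite gt_eqF.
have Ln0 : L != 0 by rewrite gt_eqF.
have c10 := tube_cst1_ge0 k K0.
have c20 := tube_cst2_ge0 k K0 (ltW m0).
have H := slice_tube tau J12 d01 K0 m0 lip_abar exp_a.
move: c10 c20 H; move: (tube_cst1 k K) (tube_cst2 k K m) => c1 c2 c10 c20 H.
have q0 : 0 <= (8 + 12 * K) / L by rewrite divr_ge0// ?ltW//; lra.
have t0 := enorm_ge0 (remove_coord ord_max tau).
set t := enorm (remove_coord ord_max tau) in H t0 *.
have [[v0 Sv0]|none] := pselect (exists v, S v); last first.
  rewrite (_ : S = set0); last by rewrite -subset0 => v Sv; apply: none; exists v.
  rewrite (measure0 (@lebesgue_rV R k.+4)) lee_fin.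
  apply: mulr_ge0; last exact: sqr_ge0.
  by apply: mulr_ge0; lra.
(* Replacing g a s by g a r costs K |r - s|, and | |X| - |X - T| | <= t gives |r - s| <= t + 2 d. *)
have diff v r s : witness J g a abar d tau v r s ->
    `|g abar r - g a r - tau 0 ord_max| <= 2 * d + K * (t + 2 * d).
  move=> [[Jr Js] q1 q2 q3 q4].
  have rs : `|r - s| <= t + 2 * d.
    have := enorm_dist (remove_coord ord_max v)
      (remove_coord ord_max v - remove_coord ord_max tau).
    rewrite subKr -/t.
    by move: q1 q2; rewrite !ler_norml; lra.
  have : `|g a r - g a s| <= K * (t + 2 * d).
    by apply: le_trans (lip_a _ _ Jr Js) _; rewrite ler_wpM2l.
  by move: q3 q4; rewrite !ler_norml; lra.
have [p [s0 w0]] := intersection_witness Sv0.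
have Jp : J p by have [[]] := w0.
(* Two witnesses have values of g abar - g a within twice the bound [diff]; expansion by L then
   confines the radii. *)
pose l := 2 * (2 * d + K * (t + 2 * d)) / L.
have l0 : 0 <= l.
  have h1 : 0 <= t + 2 * d by lra.
  have h2 : 0 <= K * (t + 2 * d) by rewrite mulr_ge0.
  have h3 : 0 <= 2 * (2 * d + K * (t + 2 * d)) by lra.
  by rewrite divr_ge0// ltW.
have near v : S v ->
    exists2 r, (exists s, witness J g a abar d tau v r s) & `|r - p| <= l.
  move=> /intersection_witness[r [s w]]; exists r; first by exists s.
  have Jr : J r by have [[]] := w.
  rewrite /l ler_pdivlMr// mulrC; apply: le_trans (exp_L _ _ Jr Jp) _.
  by move: (diff _ _ _ w) (diff _ _ _ w0); rewrite !ler_norml; lra.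
(* For t < d, the inequality t + 2 d <= 3 d bounds the number of slices by (8 + 12 K) / L + 1. *)
have [td|dt] := ltP t d.
  have cd0 : 0 <= c1 * d ^+ 2 by rewrite mulr_ge0// sqr_ge0.
  have slices := lebesgue_rV_slices d0 l0 cd0 near.
  apply: le_trans (slices _) _.
    move=> c; have [E [mE E1 _ EP]] := H c; exists E; split => // v r _ [s w].
    exact: EP w.
  rewrite lee_fin mulrA; apply: ler_wpM2r; first exact: sqr_ge0.
  apply: ler_pM => //; last by lra.
    have l2 : 0 <= 2 * l by lra.
    by have := divr_ge0 l2 (ltW d0); lra.
  rewrite lerD2r ler_pdivrMr// /l.
  have : 0 <= L^-1 * (K * (d - t)) by rewrite !mulr_ge0 ?subr_ge0// ltW ?invr_gt0.
  by lra.
(* For t >= d the number of slices may grow like t / d, which the gain d / t in the measure of each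
   slice compensates. *)
have tp : 0 < t by lra.
have cd0 : 0 <= c2 * d ^+ 3 / t by rewrite divr_ge0 ?mulr_ge0 ?exprn_ge0// ltW.
have slices := lebesgue_rV_slices d0 l0 cd0 near.
apply: le_trans (slices _) _.
  move=> c; have [E [mE _ /(_ tp) E1 EP]] := H c; exists E; split => // v r _ [s w].
  exact: EP w.
rewrite lee_fin.
have -> : (2 * l / d + 1) * (c2 * d ^+ 3 / t) =
    ((2 * l + d) / t) * c2 * d ^+ 2 by field; rewrite dn0 gt_eqF.
apply: ler_wpM2r; first exact: sqr_ge0.
apply: ler_pM => //; last by lra.
  by apply: divr_ge0 => //; lra.
rewrite ler_pdivrMr// /l.
have : 0 <= L^-1 * (K * (t - d)) by rewrite !mulr_ge0 ?subr_ge0// ltW ?invr_gt0.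
have : 0 <= L^-1 * (t - d) by rewrite !mulr_ge0 ?subr_ge0// ltW ?invr_gt0.
by lra.
Qed.

End intersection_bound.

(** * One-variable estimates for g *)

Section derivative_within.
Variable R : realType.

(** Multiplying by |s - t| turns the limit of the quotient into a first-order estimate that also
    covers s = t. *)
Lemma within_quotient_eps (I : set R) (f : R -> R) (t l : R) :
  (f s - f t) / (s - t) @[s --> within I t^'] --> l ->
  forall e, 0 < e -> exists2 h, 0 < h & forall s, I s -> `|s - t| < h ->
    `|f s - f t - l * (s - t)| <= e * `|s - t|.
Proof.
move=> /cvgrPdist_le cvf e e0; have := cvf e e0.
rewrite near_withinE => /nbhs_normP[h /= h0 H]; exists h => // s Is sh.
have [->|st] := eqVneq s t; first by rewrite !subrr mulr0 subr0 normr0 mulr0.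
have st0 : s - t != 0 by rewrite subr_eq0.
have := H s; rewrite /ball_/= distrC => /(_ sh st Is).
rewrite -(@ler_pM2r _ `|s - t|) ?normr_gt0// -normrM mulrBl divfK// distrC.
by [].
Qed.

(** The usual theorem asks for two-sided derivatives inside [r, s] and continuity up to its ends.
    Both follow from the first-order estimate, since interior points have a neighbourhood inside the
    interval. *)
Lemma MVT_within (t0 t1 : R) (f df : R -> R) :
  (forall t, `[t0, t1]%classic t ->
    (f s - f t) / (s - t) @[s --> within `[t0, t1]%classic t^'] --> df t) ->
  forall r s, `[t0, t1]%classic r -> `[t0, t1]%classic s -> r < s ->
  exists2 c, `[t0, t1]%classic c & f s - f r = df c * (s - r).
Proof.
move=> dfP r s Ir Is rs.
have sub x : x \in `[r, s] -> `[t0, t1]%classic x.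
  by move: Ir Is; rewrite /= !in_itv/=; lra.
have [||c crs cE] := @MVT R f df r s rs.
- move=> x xrs.
  have Ix : `[t0, t1]%classic x by apply: sub; exact: subset_itv_oo_cc xrs.
  have eps := within_quotient_eps (dfP x Ix).
  have cv : (fun h : R => h^-1 *: ((f \o shift x) (h *: (1 : R)) - f x)) @ 0^' --> df x.
    apply/cvgrPdist_le => e e0; have [h h0 H] := eps e e0.
    have [k /= k0 Hk] := near_in_itvoo xrs.
    near=> z.
    have z0 : z != 0 by near: z; exact: nbhs_dnbhs_neq.
    have zh : `|z| < h by near: z; exact: dnbhs0_lt.
    have zk : `|z| < k by near: z; exact: dnbhs0_lt.
    have Iz : `[t0, t1]%classic (z + x).
      apply: sub; apply: subset_itv_oo_cc; apply: Hk.
      by rewrite /= opprD addrCA subrr addr0 normrN.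
    have := H _ Iz; rewrite addrK => /(_ zh).
    rewrite /= /shift/= !scaler1 -(@ler_pM2r _ `|z|^-1) ?invr_gt0 ?normr_gt0//.
    rewrite mulfK ?normr_eq0// -normfV -normrM mulrBl mulfK// distrC.
    by rewrite [_ / z]mulrC.
  apply: DeriveDef; first by apply/cvg_ex; exists (df x).
  exact: cvg_lim cv.
- apply/subspace_continuousP => x xrs.
  have Ix : `[t0, t1]%classic x := sub x xrs.
  apply/cvgrPdist_le => e e0.
  have [h h0 H] := within_quotient_eps (dfP x Ix) (ltr01).
  (* The first-order estimate with e = 1 gives |f z - f x| <= M |z - x| near x. *)
  pose M := `|df x| + 1.
  have M0 : 0 < M by rewrite ltr_wpDl.
  rewrite near_withinE; near=> z => zrs.
  have zh : `|z - x| < h.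
    by rewrite distrC; near: z; exact: cvgr_dist_lt.
  have ze : `|z - x| <= e / M.
    rewrite distrC; near: z; apply: cvgr_dist_le => //.
    by rewrite divr_gt0.
  have := H z (sub z zrs) zh; rewrite mul1r => Hz.
  rewrite distrC; apply: (@le_trans _ _ (M * `|z - x|)).
    rewrite /M mulrDl mul1r -normrM -[f z - f x](subrK (df x * (z - x))).
    by apply: le_trans (ler_normD _ _) _; rewrite addrC lerD2l.
  by rewrite mulrC -ler_pdivlMr.
exists c => //; apply: sub; exact: subset_itv_oo_cc crs.
Unshelve. all: by end_near. Qed.

(** Applied both to g(b, .), for its Lipschitz and expansion constants, and to g(abar, .) - g(a,
    .). *)
Lemma within_diff_bounds (t0 t1 : R) (f df : R -> R) (lo hi : R) :
  (forall t, `[t0, t1]%classic t ->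
    (f s - f t) / (s - t) @[s --> within `[t0, t1]%classic t^'] --> df t) ->
  (forall t, `[t0, t1]%classic t -> lo <= `|df t| <= hi) ->
  forall r s, `[t0, t1]%classic r -> `[t0, t1]%classic s ->
  lo * `|r - s| <= `|f r - f s| <= hi * `|r - s|.
Proof.
move=> dfP bd r s Ir Is.
wlog rs : r s Ir Is / r <= s.
  move=> H; have [/H|/ltW/H] := leP r s; first exact.
  by rewrite (distrC s) (distrC (f s)); exact.
move: rs; rewrite le_eqVlt => /predU1P[->|rs]; first by rewrite !subrr normr0 !mulr0 lexx.
have [c Ic cE] := MVT_within dfP Ir Is rs.
rewrite distrC (distrC (f r)) cE normrM.
by have /andP[h1 h2] := bd c Ic; rewrite !ler_wpM2r.
Qed.

End derivative_within.

(** * Pointwise bounds from the norms of g *)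

Section regularity.
Variable R : realType.
Implicit Types (A I : set R) (g h : R -> R -> R).

Lemma sup_norm_ge A I h a t : A a -> I t -> (`|h a t|%:E <= sup_norm A I h)%E.
Proof. by move=> Aa It; apply: ereal_sup_ubound; exists (a, t). Qed.

Lemma lip_norm_ge A I h a b s t : A a -> A b -> I s -> I t -> (b, t) != (a, s) ->
  ((`|h b t - h a s| / (`|b - a| + `|t - s|))%:E <= lip_norm A I h)%E.
Proof.
move=> Aa Ab Is It neq; apply: ereal_sup_ubound.
by exists ((a, s), (b, t)).
Qed.

Lemma lip_norm_le A I h (K : R) : (lip_norm A I h <= K%:E)%E ->
  forall a b s t, A a -> A b -> I s -> I t ->
  `|h b t - h a s| <= K * (`|b - a| + `|t - s|).
Proof.
move=> hK a b s t Aa Ab Is It.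
have [[-> ->]|neq] := eqVneq (b, t) (a, s).
  by rewrite !subrr !normr0 addr0 mulr0.
have := le_trans (lip_norm_ge h Aa Ab Is It neq) hK.
rewrite lee_fin ler_pdivrMr// lt_neqAle addr_ge0// andbT eq_sym.
apply: contra neq; rewrite paddr_eq0// !normr_eq0 !subr_eq0.
by move=> /andP[/eqP -> /eqP ->].
Qed.

(** Two distinct times keep the supremum from being over the empty set, where it would be -oo, even
    if A is one point. *)
Lemma lip_norm_ge0 A I h a s t : A a -> I s -> I t -> s != t ->
  (0 <= lip_norm A I h)%E.
Proof.
move=> Aa Is It st.
have neq : (a, t) != (a, s) by rewrite xpair_eqE eqxx/= eq_sym.
apply: le_trans (lip_norm_ge h Aa Aa Is It neq).
by rewrite lee_fin divr_ge0// addr_ge0.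
Qed.

Lemma reg_norm_bounds A I g a s t : A a -> I s -> I t -> s != t ->
  (reg_norm A I g < +oo)%E ->
  [/\ has_t_derivatives A I g, 0 <= fine (reg_norm A I g),
    (sup_norm A I (partial_t I g) <= (fine (reg_norm A I g))%:E)%E &
    (lip_norm A I (partial_t I g) <= (fine (reg_norm A I g))%:E)%E].
Proof.
move=> Aa Is It st; rewrite /reg_norm; case: asboolP => // hd.
have s0 : (0 <= sup_norm A I (partial_t I g))%E.
  exact: le_trans (sup_norm_ge (partial_t I g) Aa Is).
have l1 := lip_norm_ge0 (partial_t I g) Aa Is It st.
have l2 := lip_norm_ge0 (partial_t I (partial_t I g)) Aa Is It st.
move: s0 l1 l2.
move: (sup_norm _ _ _) (lip_norm _ _ (partial_t I g)) => x y.
move: (lip_norm _ _ _) => z x0 y0 z0 fin.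
have xyz0 : (0 <= x + y + z)%E by rewrite !adde_ge0.
have xyzf : (x + y + z)%E \is a fin_num by rewrite ge0_fin_numE.
split => //; first exact: fine_ge0.
  by rewrite fineK// -addeA leeDl// adde_ge0.
by rewrite fineK// addeAC leeDr// adde_ge0.
Qed.

(** The Lipschitz bound makes |g_t| continuous on the compact rectangle, so it attains its minimum,
    which is positive because g_t has no zero. *)
Lemma inf_abs_partial_t_gt0 (a0 a1 t0 t1 K : R) g : a0 <= a1 -> t0 <= t1 ->
  let A := `[a0, a1]%classic in let I := `[t0, t1]%classic in
  0 <= K -> (lip_norm A I (partial_t I g) <= K%:E)%E ->
  (forall a t, A a -> I t -> partial_t I g a t != 0) ->
  0 < fine (inf_abs_partial_t A I g) /\
  forall a t, A a -> I t -> fine (inf_abs_partial_t A I g) <= `|partial_t I g a t|.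
Proof.
move=> a01 t01 A I K0 lipK neq0.
have Aa0 : A a0 by rewrite /A/= in_itv/= lexx.
have It0 : I t0 by rewrite /I/= in_itv/= lexx.
pose f (p : R * R) := `|partial_t I g p.1 p.2|.
have cf : {within A `*` I, continuous f}.
  apply/subspace_continuousP => -[a t] [/= Aa It].
  apply/cvgrPdist_le => e e0.
  have K1 : 0 < 2 * (K + 1) by lra.
  rewrite near_withinE; near=> z => -[Az Iz].
  apply: le_trans (ler_dist_dist _ _) _.
  apply: le_trans (lip_norm_le lipK Az Aa Iz It) _.
  have z1 : `|a - z.1| <= e / (2 * (K + 1)).
    near: z; apply: cvgr_dist_le; first exact: cvg_fst.
    by rewrite divr_gt0.
  have z2 : `|t - z.2| <= e / (2 * (K + 1)).
    near: z; apply: cvgr_dist_le; first exact: cvg_snd.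
    by rewrite divr_gt0.
  apply: (@le_trans _ _ ((K + 1) * (e / (2 * (K + 1)) + e / (2 * (K + 1))))).
    by apply: ler_pM => //; [lra|exact: lerD].
  rewrite le_eqVlt; apply/orP; left; apply/eqP; field.
  by rewrite gt_eqF//; lra.
have cAI : compact (A `*` I) by apply: compact_setX; exact: segment_compact.
have [|c] := compact_EVT_min _ cAI cf; first by exists (a0, t0).
rewrite inE => -[Ac Ic] fmin.
have fc0 : 0 < f c by rewrite normr_gt0 neq0.
have lb : ((f c)%:E <= inf_abs_partial_t A I g)%E.
  by apply: le_ereal_inf_tmp => _ [p Ap <-]; rewrite lee_fin fmin// inE.
have ub a t : A a -> I t -> (inf_abs_partial_t A I g <= `|partial_t I g a t|%:E)%E.
  by move=> Aa It; apply: ereal_inf_lbound; exists (a, t).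
have fin : inf_abs_partial_t A I g \is a fin_num.
  rewrite fin_numE gt_eqF ?(lt_le_trans _ lb) ?ltNyr//= lt_eqF//.
  exact: le_lt_trans (ub _ _ Aa0 It0) (ltry _).
split; first by rewrite -lte_fin fineK// (lt_le_trans _ lb).
by move=> a t Aa It; rewrite -lee_fin fineK// ub.
Unshelve. all: by end_near. Qed.

(** Two distinct parameters make [lambda1] finite; on a one-point A it is +oo and [fine] would
    return 0. *)
Lemma lambda1_bounds A I g : I !=set0 -> (0 < lambda1 A I g)%E ->
  forall a b, A a -> A b -> b != a -> 0 < fine (lambda1 A I g) /\
  forall t, I t -> fine (lambda1 A I g) * `|b - a| <=
    `|partial_t I g b t - partial_t I g a t|.
Proof.
move=> [t0 It0] l0 a b Aa Ab ba.
have ub t : I t -> (lambda1 A I g <=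
    (`|partial_t I g b t - partial_t I g a t| / `|b - a|)%:E)%E.
  move=> It; apply: (@le_trans _ _ (ereal_inf
      [set (`|partial_t I g p.2 t - partial_t I g p.1 t| / `|p.2 - p.1|)%:E
      | p in [set p : R * R | A p.1 /\ A p.2 /\ p.2 != p.1]])).
    by apply: ereal_inf_lbound; exists t.
  by apply: ereal_inf_lbound; exists (a, b).
have fin : lambda1 A I g \is a fin_num.
  by rewrite ge0_fin_numE ?ltW//; exact: le_lt_trans (ub _ It0) (ltry _).
split; first by rewrite -lte_fin fineK.
move=> t It; rewrite -ler_pdivlMr ?normr_gt0 ?subr_eq0//.
by rewrite -lee_fin fineK// ub.
Qed.

End regularity.

(** * Assembling the constants *)

Section constants.
Variable R : realType.

(** For D <= d the denominator d + D is at most 2 d. *)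
Lemma near_bound (d D c : R) : 0 < d -> 0 <= D -> D <= d -> 0 <= c ->
  3 * c * d <= 6 * c * (d ^+ 2 / (d + D)).
Proof.
move=> d0 D0 Dd c0; have s0 : 0 < d + D by lra.
rewrite mulrA ler_pdivlMr//.
have : 0 <= c * d * (d - D) by rewrite !mulr_ge0 ?subr_ge0// ltW.
by lra.
Qed.

(** The summand 1 is absorbed through l D <= 2 K, which turns 12 K into 14 K, and d + D <= 2 D
    produces the factor 2. *)
Lemma separated_bound (d D K l c : R) :
  0 < d -> d <= D -> 0 <= K -> 0 < l -> l * D <= 2 * K -> 0 <= c ->
  ((8 + 12 * K) / (l * D) + 1) * c * d ^+ 2 <=
  2 * ((8 + 14 * K) / l) * c * (d ^+ 2 / (d + D)).
Proof.
move=> d0 dD K0 l0 lDK c0; have s0 : 0 < d + D by lra.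
have D0 : 0 < D by lra.
have lD0 : 0 < l * D by rewrite mulr_gt0.
have -> : ((8 + 12 * K) / (l * D) + 1) * c * d ^+ 2 =
    (8 + 12 * K + l * D) / (l * D) * (c * d ^+ 2).
  by field; rewrite !gt_eqF.
have -> : 2 * ((8 + 14 * K) / l) * c * (d ^+ 2 / (d + D)) =
    (8 + 14 * K) * (2 / (l * (d + D))) * (c * d ^+ 2).
  by field; rewrite !gt_eqF.
have cd0 : 0 <= c * d ^+ 2 by rewrite mulr_ge0// sqr_ge0.
apply: ler_wpM2r => //; apply: ler_pM; [lra|by rewrite invr_ge0 ltW|lra|].
rewrite ler_pdivlMr ?mulr_gt0// mulrC ler_pdivrMr//.
have : l * d <= l * D by rewrite ler_pM2l.
lra.
Qed.

End constants.

Theorem theorem1p3 (R : realType) (n : nat) (hn : (4 <= n)%N) :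
  exists C : R -> \bar R -> \bar R -> \bar R -> R,
    forall (a0 a1 t0 t1 : R) (g : R -> R -> R),
      a0 <= a1 -> 1 <= t0 -> t0 < t1 -> t1 <= 2 ->
      let A := `[a0, a1]%classic in
      let I := `[t0, t1]%classic in
      let I' := `[t1 - (t1 - t0) / 2, t1]%classic in
      nondegenerate_away_from_origin A I g ->
      forall a abar : R, A a -> A abar ->
      forall delta : R, 0 < delta < 1 ->
        (ereal_sup
          [set lebesgue_rV
                 (translate (neighbourhood (Gamma I' g a) delta) tau
                  `&` neighbourhood (Gamma I' g abar) delta)
          | tau in [set: 'rV[R]_n.-1.+1]]
        <= (C (t1 - t0) (reg_norm A I g) (inf_abs_partial_t A I g)
              (lambda1 A I g)
            * (delta ^+ 2 / (delta + `|abar - a|)))%:E)%E.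
Proof.
case: n hn => [|[|[|[|k]]]]// _.
(* The first summand serves |abar - a| <= delta, the second the separated case. If A is one point,
   [lam] is +oo and [fine lam] is 0, so the second summand is 0; then abar = a and the first case
   applies. *)
exists (fun _ reg inf lam =>
  6 * tube_cst1 k (fine reg) + 2 * ((8 + 14 * fine reg) / fine lam) *
    (tube_cst1 k (fine reg) + tube_cst2 k (fine reg) (fine inf))).
move=> a0 a1 t0 t1 g a01 t01 t0t1 t12 A I I' [regfin [neq0 lam0]].
move=> a abar Aa Aabar d d01; have /andP[d0 d1] := d01.
have It0 : I t0 by rewrite /I/= in_itv/= lexx ltW.
have It1 : I t1 by rewrite /I/= in_itv/= lexx ltW.
have t01n : t0 != t1 by rewrite lt_eqF.
have [der K0 supK lipK] := reg_norm_bounds Aa It0 It1 t01n regfin.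
set K := fine (reg_norm A I g) in K0 supK lipK *.
have [m0 infm] := inf_abs_partial_t_gt0 a01 (ltW t0t1) K0 lipK neq0.
set m := fine (inf_abs_partial_t A I g) in m0 infm *.
have l0 : 0 <= fine (lambda1 A I g) by rewrite fine_ge0// ltW.
have gtK b t : A b -> I t -> `|partial_t I g b t| <= K.
  by move=> Ab It; rewrite -lee_fin (le_trans (sup_norm_ge (partial_t I g) Ab It)).
have I'I r : I' r -> I r by rewrite /I' /I/= !in_itv/=; lra.
have J12 r : I' r -> 1 <= r <= 2 by rewrite /I'/= in_itv/=; lra.
have dg b t : A b -> I t ->
    (g b s - g b t) / (s - t) @[s --> within I t^'] --> partial_t I g b t.
  by move=> Ab It; have [] := der b t Ab It.
have bounds b r s : A b -> I' r -> I' s ->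
    m * `|r - s| <= `|g b r - g b s| <= K * `|r - s|.
  move=> Ab /I'I Ir /I'I Is.
  apply: (@within_diff_bounds R t0 t1 (g b) (partial_t I g b)) => // t It.
    exact: dg.
  by rewrite infm// gtK.
have lip b r s : A b -> I' r -> I' s -> `|g b r - g b s| <= K * `|r - s|.
  by move=> Ab Ir Is; have /andP[] := bounds b r s Ab Ir Is.
have expm r s : I' r -> I' s -> m * `|r - s| <= `|g a r - g a s|.
  by move=> Ir Is; have /andP[] := bounds a r s Aa Ir Is.
have c1 : 0 <= tube_cst1 k K := tube_cst1_ge0 k K0.
have c2 : 0 <= tube_cst2 k K m := tube_cst2_ge0 k K0 (ltW m0).
have q0 : 0 <= 2 * ((8 + 14 * K) / fine (lambda1 A I g)).
  have K14 : 0 <= 8 + 14 * K by lra.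
  by rewrite mulr_ge0// divr_ge0.
have dd0 : 0 <= d ^+ 2 / (d + `|abar - a|).
  by rewrite divr_ge0 ?sqr_ge0// addr_ge0// ltW.
apply: ge_ereal_sup => _ [tau _ <-].
have [Dd|dD] := leP `|abar - a| d.
  apply: le_trans (intersection_le tau J12 d01 K0 m0
    (fun r s => @lip abar r s Aabar) expm) _.
  rewrite lee_fin; apply: le_trans (near_bound d0 _ Dd c1) _ => //.
  by rewrite ler_wpM2r// lerDl mulr_ge0// addr_ge0.
have neq : abar != a.
  by apply: contraTneq dD => ->; rewrite subrr normr0 -leNgt ltW.
have [|lp lamP] := lambda1_bounds _ lam0 Aa Aabar neq; first by exists t0.
set l := fine (lambda1 A I g) in l0 q0 lp lamP *.
have lD0 : 0 < l * `|abar - a| by rewrite mulr_gt0//; lra.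
(* The derivative of g(abar, .) - g(a, .) is at least l |abar - a| in absolute value by the
   definition of [lambda1]. *)
have expL r s : I' r -> I' s -> l * `|abar - a| * `|r - s| <=
    `|(g abar r - g a r) - (g abar s - g a s)|.
  move=> /I'I Ir /I'I Is.
  have dgB t : I t -> ((g abar s - g a s) - (g abar t - g a t)) / (s - t)
      @[s --> within I t^'] --> partial_t I g abar t - partial_t I g a t.
    move=> It.
    have -> : (fun s => ((g abar s - g a s) - (g abar t - g a t)) / (s - t)) =
        (fun s => (g abar s - g abar t) / (s - t) - (g a s - g a t) / (s - t)).
      by apply/funext => x; rewrite -mulrBl; congr (_ / _); ring.
    exact: cvgB (dg abar t Aabar It) (dg a t Aa It).
  have bd t : I t -> l * `|abar - a| <=
      `|partial_t I g abar t - partial_t I g a t| <= 2 * K.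
    move=> It; rewrite lamP//= (le_trans (ler_normB _ _))//.
    by have := gtK abar t Aabar It; have := gtK a t Aa It; lra.
  by have /andP[] := within_diff_bounds dgB bd Ir Is.
have lDK : l * `|abar - a| <= 2 * K.
  apply: le_trans (lamP _ It0) (le_trans (ler_normB _ _) _).
  by have := gtK abar t0 Aabar It0; have := gtK a t0 Aa It0; lra.
apply: le_trans (intersection_le_separated tau J12 d01 K0 m0 lD0
  (fun r s => @lip a r s Aa) (fun r s => @lip abar r s Aabar) expm expL) _.
rewrite lee_fin; apply: le_trans (separated_bound d0 (ltW dD) K0 lp lDK _) _.
  exact: addr_ge0.
by rewrite ler_wpM2r// lerDr mulr_ge0.
Qed.
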